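(* Let $s\in(0,1)$, let $h>0$ be an integer, let $x_0\in(0,1)$ be an initial point such that the empirical measures $\mu_n$ of the orbit of $x_0$ converge weakly to $\mu_s$, and let $\{X_n\}_{n\in\mathbb{N}}$ be a Manneville-Pomeau process with parameter $s$, $X_n=\varphi(T_s^n(U_0))$, with $\varphi\in\mathcal{L}^1(\mu_s)$ almost everywhere increasing. For $(u,v)\in I^2$ let $$C_{m,n}(u,v;h)=\left(\sum_{k=0}^{n_0^*-1}\mu_n\Big(\big[a_{h,k}^m,\mathcal{T}_{h,k}^m(F_n^{-1}(v))\big]\Big)\right)\delta_{\mathbb{N}^*}(n_0^* )+\mu_n\Big(\big[a_{h,n_0^*}^m,\min\{F_n^{-1}(u),\mathcal{T}_{h,n_0^*}^m(F_n^{-1}(v))\}\big]\Big),$$ where $n_0^*=n_0^*(m,n)\in\{0,\dots,2^h-1\}$ is the index $k$ for which $u\in[F_n(a_{h,k}^m),F_n(a_{h,k+1}^m))$ (with $n_0^*=2^h-1$ if $u=1$), and $\delta_{\mathbb{N}^*}(x)$ equals $1$ if $x\in\mathbb{N}^*$ and $0$ otherwise. Then, for all $(u,v)\in I^2$ and $t\ge0$, $$\lim_{n\to\infty}\lim_{m\to\infty}C_{m,n}(u,v;h)=\lim_{m\to\infty}\lim_{n\to\infty}C_{m,n}(u,v;h)=\lim_{m,n\to\infty}C_{m,n}(u,v;h),$$ and the common limit is $C_{X_t,X_{t+h}}(u,v)$, the copula of $(X_t,X_{t+h})$. Furthermore, the limits above are uniform in $(u,v)\in I^2$.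
   Context: $I=[0,1]$, $\mathbb{N}=\{0,1,2,\dots\}$, $\mathbb{N}^*=\mathbb{N}\setminus\{0\}$, $\lambda$ is Lebesgue measure on $I$. For $s>0$ the Manneville-Pomeau transformation $T_s:I\to I$ is $T_s(x)=x+x^{1+s}\ (\mathrm{mod}\ 1)$, i.e. $T_s(x)=x+x^{1+s}$ if $x+x^{1+s}<1$ and $T_s(x)=x+x^{1+s}-1$ otherwise (so $T_s(1)=1$); $T_s^k$ is its $k$-fold composition. For $s\in(0,1)$, $\mu_s$ denotes the $T_s$-invariant Borel probability measure on $I$ that is absolutely continuous with respect to $\lambda$; it is ergodic and has a positive density, so $F_0(x):=\mu_s([0,x])$ is a continuous, strictly increasing bijection of $I$. $U_0$ is a random variable with law $\mu_s$, and for $\varphi:I\to\mathbb{R}$ in $\mathcal{L}^1(\mu_s)$ the process $X_t=\varphi(T_s^t(U_0))$, $t\in\mathbb{N}$, is a Manneville-Pomeau process. ''Almost everywhere increasing'' means strictly increasing on $I\setminus N$ for some $\lambda$-null set $N$. Nodes and branch inverses. $T_s^h$ has $2^h$ branches, on each of which it is continuous and strictly increasing; $0=a_{h,0}<\dots<a_{h,2^h}=1$ are their end points, $[a_{h,k},a_{h,k+1})$ is the $k$-th node, and $\mathcal{T}_{h,k}:I\to[a_{h,k},a_{h,k+1}]$ is the inverse of $T_s^h$ restricted to its $k$-th node (extended by continuity). Empirical quantities (index $n$). $\mu_n(A)=\frac1n\sum_{k=0}^{n-1}\delta_{T_s^k(x_0)}(A)$, where $\delta_a$ is the Dirac measure at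 $a$, and $x_0\in(0,1)$ is fixed such that $\mu_n(A)\to\mu_s(A)$ for every $\mu_s$-continuity set $A$ (true for almost every $x_0$; the orbit points are then pairwise distinct). $\widehat F_n(x)=\mu_n([0,x])$ is the empirical distribution function, with jump points $x_{(1)}<\dots<x_{(n)}$; put $x_{(0)}=0$, $x_{(n+1)}=1$. $F_n:I\to I$ is the continuous function that equals $\widehat F_n$ at the points $x_{(0)},\dots,x_{(n+1)}$ and is linear between consecutive ones. $F_n^{-1}(y)=\inf\{x\in I:F_n(x)\ge y\}$. Partition quantities (index $m$). Let $I_m=\{0=z_1<z_2<\dots<z_m=1\}$ be nested finite sets ($I_m\subset I_{m+1}$, with $I_{m+1}$ having one more point) with mesh tending to $0$ as $m\to\infty$; $m$ is always taken large enough ($m\ge2^h$, at least) that the points $T_s^h(z_i)$ reflect all $2^h-1$ discontinuities of $T_s^h$, i.e. that $D=\{i:T_s^h(z_i)>T_s^h(z_{i+1})\}$ has exactly $2^h-1$ elements $d_1<\dots<d_{2^h-1}$, with $[z_{d_i},z_{d_i+1}]$ containing the $i$-th discontinuity $a_{h,i}$. Put $d_0=0$, $d_{2^h}=m$. With $T^*_h(x)=T_s^{h-1}(x)+(T_s^{h-1}(x))^{1+s}$, the approximate nodes are $a_{h,0}^m=0$, $a_{h,2^h}^m=1$ and, for $1\le i\le 2^h-1$, $$a_{h,i}^m=z_{d_i}+\frac{z_{d_i+1}-z_{d_i}}{T^*_h(z_{d_i+1})-T^*_h(z_{d_i})}\big(1-T^*_h(z_{d_i})\big).$$ For $i=0,\dots,2^h-1$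 let $x_{h,i}^{(1)},\dots,x_{h,i}^{(p_i)}$ be the points $a_{h,i}^m,z_{d_i+1},\dots,z_{d_{i+1}},a_{h,i+1}^m$ and let $y_{h,i}^{(1)},\dots,y_{h,i}^{(p_i)}$ be the corresponding values $0,T_s^h(z_{d_i+1}),\dots,T_s^h(z_{d_{i+1}}),1$ (repeated points omitted). The approximate branch inverse $\mathcal{T}_{h,i}^m:I\to I$ is the linear interpolation: for $y\in[y_{h,i}^{(k)},y_{h,i}^{(k+1)})$, $$\mathcal{T}_{h,i}^m(y)=x_{h,i}^{(k)}+\frac{x_{h,i}^{(k+1)}-x_{h,i}^{(k)}}{y_{h,i}^{(k+1)}-y_{h,i}^{(k)}}\big(y-y_{h,i}^{(k)}\big),$$ and $\mathcal{T}_{h,i}^m(1)=a_{h,i+1}^m$. Limits as $m\to\infty$ are taken along the sequence of refining partitions.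
   Formalization: The inner limit of C_{m,n} as m→∞ at fixed n is claimed only pointwise in (u,v), since uniformity there fails (jumps of size 1/n at orbit points outside all I_m); the outer limits, the inner limit n→∞ at fixed m and the joint limit are uniform. *)

(* Defs.v *)
From HB Require Import structures.
From mathcomp Require Import all_boot all_order all_algebra.
From mathcomp Require Import all_classical all_reals all_analysis.

Set Implicit Arguments.
Unset Strict Implicit.
Unset Printing Implicit Defensive.

Import Order.TTheory GRing.Theory Num.Theory.
Import numFieldNormedType.Exports.

Local Open Scope classical_set_scope.
Local Open Scope ring_scope.

Definition unit_interval {R : realType} : set R := `[0, 1].

Definition unit_square {R : realType} : set (R * R) :=
  unit_interval `*` unit_interval.

(* Functions on I = [0, 1] are functions on R of which only the values on I
   matter; measures on I are measures on R carried by I. *)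

Definition MP {R : realType} (s x : R) : R :=
  let y := x + x `^ (1 + s) in if y < 1 then y else y - 1.

Record is_MP_measure {R : realType} (s : R) (mu : probability R R) : Prop :=
  IsMPMeasure {
    MP_measure_carrier : mu unit_interval = 1%E ;
    MP_measure_invariant : forall A : set R,
      measurable A -> mu (MP s @^-1` A) = mu A ;
    MP_measure_ac : mu `<< lebesgue_measure ;
    MP_measure_ergodic : forall A : set R,
      measurable A -> A `<=` unit_interval ->
      unit_interval `&` MP s @^-1` A = A -> mu A = 0%E \/ mu A = 1%E ;
    MP_measure_density : exists f : R -> R,
      [/\ measurable_fun setT f,
          forall x, unit_interval x -> 0 < f x
        & forall A : set R, measurable A -> A `<=` unit_interval ->
            mu A = (\int[lebesgue_measure]_(x in A) (f x)%:E)%E] }.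

Definition ae_increasing {R : realType} (phi : R -> R) : Prop :=
  exists2 N : set R, lebesgue_measure.-negligible N &
    forall x y, (unit_interval `\` N) x -> (unit_interval `\` N) y ->
      x < y -> phi x < phi y.

Record is_copula {R : realType} (C : R * R -> R) : Prop := IsCopula {
  copula_u0 : forall u, unit_interval u -> C (u, 0) = 0 ;
  copula_0v : forall v, unit_interval v -> C (0, v) = 0 ;
  copula_u1 : forall u, unit_interval u -> C (u, 1) = u ;
  copula_1v : forall v, unit_interval v -> C (1, v) = v ;
  copula_2increasing : forall u1 u2 v1 v2,
    unit_interval u1 -> unit_interval u2 ->
    unit_interval v1 -> unit_interval v2 -> u1 <= u2 -> v1 <= v2 ->
    0 <= C (u2, v2) - C (u2, v1) - C (u1, v2) + C (u1, v1) }.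

(* Sklar's relation between the joint and the marginal distribution
   functions. *)
Definition copula_of d {Om : measurableType d} {R : realType}
    {P : probability Om R} (X Y : {RV P >-> R}) (C : R * R -> R) : Prop :=
  is_copula C /\
  forall x y : R, P (X @^-1` `]-oo, x] `&` Y @^-1` `]-oo, y]) =
    (C (fine (cdf X x), fine (cdf Y y)))%:E.

(* Linear interpolation through the points (abscissa, ordinate) of ps, whose
   abscissae are nondecreasing; after the last abscissa the value is the last
   ordinate. Between two equal abscissae the half-open interval is empty, so
   that repeated points have no effect and no division by 0 is used. *)
Fixpoint interpolation {R : realType} (ps : seq (R * R)) (x : R) : R :=
  match ps with
  | [::] => 0
  | p :: ps' =>
    match ps' with
    | [::] => p.2
    | q :: _ =>
      if p.1 <= x < q.1 then p.2 + (q.2 - p.2) / (q.1 - p.1) * (x - p.1)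
      else interpolation ps' x
    end
  end.

Section empirical.
Context {R : realType} (s x0 : R) (n : nat).

Definition orbit_points : seq R := [seq iter k (MP s) x0 | k <- iota 0 n].

(* Up to the embedding of R in \bar R, \1_A a is \d_a A. *)
Definition mu_emp (A : set R) : R :=
  n%:R^-1 * \sum_(k < n) \1_A (iter k (MP s) x0).

Definition Fhat (x : R) : R := mu_emp `[0, x].

Definition Fn : R -> R :=
  interpolation
    [seq (x, Fhat x) | x <- 0 :: rcons (sort <=%R orbit_points) 1].

Definition Fn_inv (y : R) : R :=
  inf [set x | unit_interval x /\ y <= Fn x].

End empirical.

(* The boundary of A is taken in R; for A included in I it differs from the
   boundary in I at most by the points 0 and 1, which is immaterial for mu
   absolutely continuous. *)
Definition weak_cvg_emp {R : realType} (s x0 : R) (mu : probability R R) : Prop :=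
  forall A : set R, measurable A -> mu (closure A `\` A^°) = 0%E ->
    (fun n => (mu_emp s x0 n A)%:E) @ \oo --> mu A.

(* Z m is the increasing enumeration z_1 < ... < z_m of I_m, for m >= 2; the
   value of Z at 0 and 1 is irrelevant. *)
Definition zpt {R : realType} (Z : nat -> seq R) m i : R := nth 0 (Z m) i.-1.

Record refining_partitions {R : realType} (Z : nat -> seq R) : Prop :=
  RefiningPartitions {
    partition_size : forall m, (2 <= m)%N -> size (Z m) = m ;
    partition_sorted : forall m, (2 <= m)%N -> sorted <%R (Z m) ;
    partition_first : forall m, (2 <= m)%N -> zpt Z m 1 = 0 ;
    partition_last : forall m, (2 <= m)%N -> zpt Z m m = 1 ;
    partition_nested : forall m, (2 <= m)%N -> {subset Z m <= Z m.+1} ;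
    partition_mesh :
      (fun m => \big[Num.max/0]_(1 <= i < m) (zpt Z m i.+1 - zpt Z m i))
        @ \oo --> (0 : R) }.

Section approximate_nodes.
Context {R : realType} (s : R) (h : nat) (Z : nat -> seq R) (m : nat).

Definition descents : seq nat :=
  [seq i <- iota 1 m.-1
     | iter h (MP s) (zpt Z m i.+1) < iter h (MP s) (zpt Z m i)].

(* For m so large that there are 2 ^ h - 1 descents, this is
   d_0 = 0 < d_1 < ... < d_(2 ^ h - 1) < d_(2 ^ h) = m. *)
Definition dpt (i : nat) : nat := nth 0%N (0%N :: rcons descents m) i.

Definition MPstar (x : R) : R :=
  let y := iter h.-1 (MP s) x in y + y `^ (1 + s).

Definition anode (i : nat) : R :=
  if i == 0%N then 0
  else if i == (2 ^ h)%N then 1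
  else let z0 := zpt Z m (dpt i) in
       let z1 := zpt Z m (dpt i).+1 in
       z0 + (z1 - z0) / (MPstar z1 - MPstar z0) * (1 - MPstar z0).

Definition branch_inv (i : nat) : R -> R :=
  interpolation
    ((0, anode i)
     :: rcons [seq (iter h (MP s) (zpt Z m j), zpt Z m j)
                | j <- index_iota (dpt i).+1 (dpt i.+1).+1]
              (1, anode i.+1)).

Definition n0star (x0 : R) (n : nat) (u : R) : nat :=
  if u == 1 then (2 ^ h).-1
  else find (fun k => Fn s x0 n (anode k) <= u
                      < Fn s x0 n (anode k.+1))
            (iota 0 (2 ^ h)).

Definition Cmn (x0 : R) (n : nat) (uv : R * R) : R :=
  let: (u, v) := uv in
  let n0 := n0star x0 n u in
  let yu := Fn_inv s x0 n u in
  let yv := Fn_inv s x0 n v in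
  (\sum_(k < n0) mu_emp s x0 n `[anode k, branch_inv k yv])
    * (0 < n0)%N%:R
  + mu_emp s x0 n
      `[anode n0, Num.min yu (branch_inv n0 yv)].

End approximate_nodes.

(* Main.v *)
Require Import Defs.
From HB Require Import structures.
From mathcomp Require Import all_boot all_order all_algebra.
From mathcomp Require Import all_classical all_reals all_analysis.
From mathcomp Require Import measurable_realfun.
From mathcomp Require Import ring lra zify.

Import Order.TTheory GRing.Theory Num.Theory.
Import numFieldNormedType.Exports.

Local Open Scope classical_set_scope.
Local Open Scope ring_scope.

(** Write [T] for the map, [F0] for the distribution function of [mu] and [Q] for
    the inverse of [F0] on the unit interval. The process at time [t] is an
    almost everywhere increasing function of [V t = iter t T U0], which has law
    [mu]; so [X t <= x] is, up to a null event, [V t <= c] for some [c], and the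
    copula of [X t] and [X (t + h)] is
      [C (u, v) = mu {w | w <= Q u and iter h T w <= Q v}].
    Every [c] of the open interval comes from some level [x], so Sklar's
    relation leaves no choice ([lag_copula_of], [copula_unique]).

    The iterates are handled through a lift. If [branch h x] is the index of the
    node of [x], then [lift h x = branch h x + iter h T x] is a strictly
    increasing bijection of [0, 1] onto [0, 2 ^ h], Lipschitz with an inverse
    that does not increase distances.
    The nodes are its preimages of integers, the inverse of the k-th branch is
    [y |-> lift_inv h (k + y)], and the descents along a fine partition are the
    places where [branch] increases by one. Hence the approximate nodes and the
    approximate branch inverses are within one mesh of the exact ones, because
    they lie between the same partition points ([good_grid_near]).

    Cutting the event above along the nodes gives, with [a^+ = max 0 a],
      [C (u, v) = \sum_k (min u (F0 (lift_inv h (k + Q v))) - F0 (node h k))^+]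
    ([lag_copulaE]). The estimator has the same shape: the index [n0star] only
    separates the nodes where the constraint by [Fn_inv u] is void from those
    where it excludes everything, so that [Cmn] is exactly the sum over all [k]
    of the empirical measures of [anode k, min (Fn_inv u) (branch_inv k (Fn_inv v))]
    ([CmnE]). By Polya's argument the empirical measure of an interval is
    uniformly close to its [mu]-measure ([emp_close_near]), and [Fn_inv] is
    uniformly close to [Q] ([quantile_near]); the terms of the two sums are then
    compared one by one ([Cmn_dist]). This yields the joint limit ([Cmn_joint])
    and the limit in [n] for a fixed fine partition, which is the same sum with
    approximate nodes and inverses ([Cmn_grid], [grid_copula_cvg]).

    The limit in [m] for a fixed [n] needs a separate argument, as the empirical
    measure has atoms that may sit exactly at the end of a limit interval. This
    happens at an orbit point [x] with [iter h T x = Fn_inv v]. The branches of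
    [iter h T] are strictly convex, so the interpolated inverse at [iter h T x]
    stays strictly below [x] unless [x] is a partition point. The partitions
    being nested, this alternative is settled once and for all for large [m], and
    the estimator is ultimately constant in [m] ([Cmn_ultimately_constant]). *)

(** Linear arithmetic on the natural-number hypotheses alone, out of contexts
    that mostly hold facts about reals. *)
Ltac olia := repeat match goal with
  | H : is_true (leq _ _) |- _ => revert H
  | H : is_true (andb (leq _ _) (leq _ _)) |- _ => revert H
  | H : @eq nat _ _ |- _ => revert H
  end; clear; lia.

(** * Uniform continuity on the unit interval *)
Section uniform_continuity.
Context {R : realType}.

(** Uniform continuity on [0, 1] without filters: all estimates below are
    uniform in the two levels, and quantitative moduli compose directly. *)
Definition ucont (f : R -> R) := forall e : R, 0 < e -> exists2 d : R, 0 < d &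
  forall x y : R, 0 <= x <= 1 -> 0 <= y <= 1 -> `|x - y| < d -> `|f x - f y| <= e.

Lemma ucont_le (f : R -> R) : (forall e : R, 0 < e -> exists2 d : R, 0 < d &
    forall x y : R, 0 <= x -> x <= y -> y <= 1 -> y - x < d -> `|f y - f x| <= e) ->
  ucont f.
Proof.
move=> H e /H[d d0 {}H]; exists d => // x y /andP[x0 x1] /andP[y0 y1] xy.
case: (leP x y) => [xy'|/ltW yx].
  by rewrite distrC; apply: H => //; move: xy; rewrite distrC ger0_norm //; lra.
by apply: H => //; move: xy; rewrite ger0_norm //; lra.
Qed.

Lemma lipschitz_ucont (K : R) (f : R -> R) : 0 <= K ->
  (forall x y : R, 0 <= x -> x <= y -> y <= 1 -> `|f y - f x| <= K * (y - x)) -> ucont f.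
Proof.
move=> K0 H; apply: ucont_le => e e0; exists (e / (K + 1)); first by rewrite divr_gt0 //; lra.
move=> x y x0 xy y1; rewrite ltr_pdivlMr; last lra.
by have := H x y x0 xy y1; nra.
Qed.

Lemma ucont_ivt (f : R -> R) v : ucont f -> f 0 <= v <= f 1 ->
  exists2 c, 0 <= c <= 1 & f c = v.
Proof.
move=> fc /andP[f0 f1].
have [||c] := @IVT R f 0 1 v ler01.
- apply/subspace_continuousP => x /=; rewrite in_itv /= => x01.
  apply/cvgrPdist_le => e /fc[d d0 fd].
  rewrite near_withinE; near=> y => /=; rewrite in_itv /= => y01.
  apply: fd => //; near: y; exact: nbhsx_ballx.
- by rewrite ge_min le_max f0 f1 orbT.
- by rewrite in_itv /= => c01 E; exists c.
Unshelve. all: by end_near. Qed.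

(** The generalised inverse of a continuous nondecreasing function attains its
    level, since its value is a limit from the right of values at least [u]. *)
Lemma inf_level (f : R -> R) u : ucont f ->
  (forall x y : R, 0 <= x -> x <= y -> y <= 1 -> f x <= f y) -> f 0 <= u <= f 1 ->
  let c := inf [set x | unit_interval x /\ u <= f x] in
  0 <= c <= 1 /\ f c = u.
Proof.
move=> fc fm fu; set A := [set x | _].
have [b b01 fb] := ucont_ivt f u fc fu.
have Ab : A b by split; rewrite /unit_interval /= ?in_itv ?fb.
have lb : lbound A 0 by move=> x [] /=; rewrite /unit_interval /= in_itv /= => /andP[].
have hi : has_inf A by split; [exists b|exists 0].
have c0 : 0 <= inf A by apply: lb_le_inf => //; exists b.
have cb : inf A <= b by apply: ge_inf => //; exists 0.
move=> /=; have c1 : inf A <= 1 by lra.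
split; first by rewrite c0.
apply/eqP; rewrite eq_le; apply/andP; split; first by rewrite -fb; apply: fm => //; lra.
apply/ler_addgt0Pr => e /fc[d d0 fd].
have [x [] /=] := inf_adherent d0 hi.
rewrite /unit_interval /= in_itv /= => x01 ux xd.
have cx : inf A <= x by apply: ge_inf; [exists 0|split; rewrite /unit_interval /= ?in_itv].
have := fd x (inf A) x01; rewrite c0 c1 => /(_ isT); rewrite ger0_norm; last lra.
by move=> /(_ ltac:(lra)); rewrite ler_norml; lra.
Qed.

Lemma grid_point N (x : R) : (0 < N)%N -> 0 <= x <= 1 ->
  exists2 i, (i < N)%N & i%:R / N%:R <= x <= i.+1%:R / N%:R.
Proof.
case: N => // N _ /andP[x0 x1].
have P i : (i <= N)%N -> x <= i.+1%:R / N.+1%:R ->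
  exists2 i, (i < N.+1)%N & i%:R / N.+1%:R <= x <= i.+1%:R / N.+1%:R.
  elim: i => [|i IH] iN xi; first by exists 0%N => //; rewrite mul0r x0.
  case: (leP x (i.+1%:R / N.+1%:R)) => xi'; first by apply: IH => //; exact: ltnW.
  by exists i.+1 => //; rewrite (ltW xi').
by apply: (P N) => //; rewrite divff // pnatr_eq0.
Qed.

Lemma grid_mesh (e : R) : 0 < e -> exists2 N, (0 < N)%N & N%:R^-1 < e.
Proof.
move=> e0; exists (Num.truncn e^-1).+1 => //.
by rewrite invf_plt ?posrE ?ltr0n // truncnS_gt.
Qed.

Lemma finite_pos (a : nat -> R) N : (forall i, (i < N)%N -> 0 < a i) ->
  exists2 d, 0 < d & forall i, (i < N)%N -> d <= a i.
Proof.
elim: N => [|N IH] H; first by exists 1.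
have [i iN|d d0 Hd] := IH; first by apply: H; exact: ltnW.
exists (Num.min d (a N)); first by rewrite lt_min d0 H.
move=> i; rewrite ltnS leq_eqVlt => /orP[/eqP->|/Hd]; first by rewrite ge_min lexx orbT.
by rewrite ge_min => ->.
Qed.

(** The inverse of a strictly increasing function is uniformly continuous even
    where the function jumps: two points more than [e] apart enclose a whole
    cell of a grid of step less than [e / 2], and the increments over the
    finitely many cells have a positive minimum. *)
Lemma increasing_inverse_ucont (f : R -> R) :
  (forall x y : R, 0 <= x -> x < y -> y <= 1 -> f x < f y) ->
  forall e : R, 0 < e -> exists2 d : R, 0 < d & forall x y : R, 0 <= x <= 1 -> 0 <= y <= 1 ->
    `|f x - f y| < d -> `|x - y| <= e.
Proof.
move=> fi e e0; have [|N N0 Ne] := grid_mesh (e / 2); first lra.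
have Np : (0 : R) < N%:R by rewrite ltr0n.
have le_grid i j : (i < j)%N -> (i%:R / N%:R : R) < j%:R / N%:R.
  by move=> ij; rewrite ltr_pM2r ?invr_gt0 // ltr_nat.
have [i iN|d d0 Hd] := finite_pos (fun i => f (i.+1%:R / N%:R) - f (i%:R / N%:R)) N.
  rewrite subr_gt0; apply: fi; rewrite ?le_grid ?divr_ge0 ?ler0n //.
  by rewrite ler_pdivrMr // mul1r ler_nat.
have fm x y : 0 <= x -> x <= y -> y <= 1 -> f x <= f y.
  by move=> x0; rewrite le_eqVlt => /orP[/eqP->//|xy] y1; apply/ltW/fi.
have main x y : 0 <= x -> y <= 1 -> e < y - x -> d <= f y - f x.
  move=> x0 y1 xy; have [|i iN /andP[ix xi]] := grid_point N x N0; first lra.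
  have E k : k.+1%:R / N%:R = k%:R / N%:R + N%:R^-1 :> R by rewrite -natr1 mulrDl mul1r.
  have iy : i.+2%:R / N%:R <= y by move: ix; rewrite !E; lra.
  have iN' : (i.+1 < N)%N.
    by rewrite -(ler_nat R) -[leRHS]mul1r -ler_pdivrMr //; lra.
  have := Hd _ iN'; have := fm _ _ x0 xi; have := fm _ _ _ iy y1.
  move=> /(_ (divr_ge0 (ler0n _ _) (ler0n _ _))) H1 H2 H3.
  have H4 : (i.+1%:R / N%:R : R) <= 1 by rewrite ler_pdivrMr // mul1r ler_nat.
  by have := H2 H4; lra.
exists d => // x y /andP[x0 x1] /andP[y0 y1] fxy.
rewrite leNgt; apply/negP => exy.
case: (leP x y) => xy.
  have := main x y x0 y1; rewrite distrC ger0_norm in exy; last lra.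
  by move=> /(_ exy); move: fxy; rewrite ltr_norml; lra.
have := main y x y0 x1; rewrite ger0_norm in exy; last lra.
by move=> /(_ exy); move: fxy; rewrite ltr_norml; lra.
Qed.

End uniform_continuity.

(** * Linear interpolation *)
Section interpolation.
Context {R : realType}.
Implicit Types (p q r : R * R) (l : seq (R * R)).

(** For the graph of a function the ends of the segment moreover enclose no
    other abscissa. *)
Lemma interpolation_graph_locate (F : R -> R) (a : R) (l : seq R) (y : R) :
  path <=%R a l -> a <= y -> y < last a l ->
  exists q r : R, [/\ q \in a :: l, r \in a :: l, q <= y < r,
    (forall w, w \in a :: l -> w <= q \/ r <= w) &
    interpolation [seq (x, F x) | x <- a :: l] y =
      F q + (F r - F q) / (r - q) * (y - q)].
Proof.
elim: l a => [|b l IH] a; first by move=> _ ay; rewrite ltNge ay.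
move=> /andP[ab bl] ay yl.
have bmin w : w \in b :: l -> b <= w.
  have /allP bl' := order_path_min le_trans bl.
  by rewrite in_cons => /orP[/eqP->//|/bl'].
case: (ltP y b) => yb.
  exists a, b; rewrite !inE !eqxx orbT ay yb; split => //.
    by move=> w; rewrite inE => /orP[/eqP->|/bmin]; [left|right].
  by rewrite /= ay yb.
have [q [r [qI rI qr H E]]] := IH b bl yb yl.
exists q, r; split => //; [by rewrite in_cons qI orbT|by rewrite in_cons rI orbT| |].
  move=> w; rewrite in_cons => /orP[/eqP->|/H//]; left.
  exact: le_trans ab (bmin _ qI).
by rewrite -E /= (ltNge y b) yb andbF.
Qed.

Definition chord q r (y : R) := q.2 + (r.2 - q.2) / (r.1 - q.1) * (y - q.1).

Lemma interpolation_cons p q l y : interpolation (p :: q :: l) y =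
  if p.1 <= y < q.1 then chord p q y else interpolation (q :: l) y.
Proof. by []. Qed.

(** The relation [e] carries whatever is known of two consecutive points, so
    that the recursion along the list is replaced by a case analysis on the
    segment that contains [y]. *)
Lemma interpolation_locate (e : rel (R * R)) p l y : path e p l -> p.1 <= y ->
  (exists q r, [/\ e q r, q.1 <= y < r.1 & interpolation (p :: l) y = chord q r y]) \/
  ((last p l).1 <= y /\ interpolation (p :: l) y = (last p l).2).
Proof.
elim: l p => [|q l IH] p; first by move=> _ py; right.
move=> /andP[epq el] py; rewrite interpolation_cons py andTb; case: ltP => yq.
  by left; exists p, q; split => //; rewrite py.
exact: IH.
Qed.

Lemma chord_between q r y : q.1 <= y < r.1 -> q.2 <= r.2 -> q.2 <= chord q r y <= r.2.
Proof.
move=> /andP[qy yr] qr; rewrite /chord.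
have D : 0 < r.1 - q.1 by lra.
have S : 0 <= (r.2 - q.2) / (r.1 - q.1) by rewrite divr_ge0 //; lra.
have H1 : 0 <= (r.2 - q.2) / (r.1 - q.1) * (y - q.1) by rewrite mulr_ge0 //; lra.
have H2 : (r.2 - q.2) / (r.1 - q.1) * (y - q.1) <= (r.2 - q.2) / (r.1 - q.1) * (r.1 - q.1).
  by apply: ler_wpM2l => //; lra.
rewrite mulfVK in H2; last by rewrite gt_eqF.
by lra.
Qed.

(** Consecutive points without a vertical jump. Equal points are allowed since
    they occur at the ends of the interpolations below. *)
Definition step_le q r := (q.1 < r.1) && (q.2 <= r.2) || (q == r).

Lemma interpolation_head p l : path step_le p l -> interpolation (p :: l) p.1 = p.2.
Proof.
elim: l p => [|q l IH] p // /andP[].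
rewrite interpolation_cons lexx andTb.
case/orP => [/andP[pq _] _|/eqP-> el]; last by rewrite ltxx IH.
by rewrite pq /chord subrr mulr0 addr0.
Qed.

(** The slopes of the segments add up to a Lipschitz constant; the pieces are
    glued by [interpolation_head]. *)
Lemma interpolation_lipschitz p l : path step_le p l ->
  exists2 K, 0 <= K & forall x y, p.1 <= x -> x <= y ->
    0 <= interpolation (p :: l) y - interpolation (p :: l) x <= K * (y - x).
Proof.
elim: l p => [|q l IH] p.
  by move=> _; exists 0 => // x y _ _; rewrite /= subrr mul0r lexx.
move=> /andP[pq el]; have [K K0 HK] := IH q el.
have hq := interpolation_head q l el.
case/orP: pq => [/andP[pq1 pq2]|/eqP->]; last first.
  exists K => // x y qx xy; rewrite !interpolation_cons.
  by rewrite !ltNge qx (le_trans qx xy) /=; exact: HK.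
set S := (q.2 - p.2) / (q.1 - p.1).
have S0 : 0 <= S by rewrite divr_ge0 //; lra.
have SE : S * (q.1 - p.1) = q.2 - p.2 by rewrite mulfVK // gt_eqF //; lra.
exists (S + K); first lra.
move=> x y px xy; rewrite !interpolation_cons px (le_trans px xy) !andTb /chord -/S.
have yx0 : 0 <= y - x by lra.
have E1 := mulr_ge0 S0 yx0; have E2 := mulr_ge0 K0 yx0.
case: (ltP y q.1) => yq.
  by rewrite (le_lt_trans xy yq); lra.
case: (ltP x q.1) => xq; last by have := HK x y xq xy; lra.
have := HK q.1 y (lexx _) yq; rewrite hq.
have : 0 <= S * (q.1 - x) by rewrite mulr_ge0 //; lra.
have : 0 <= K * (q.1 - x) by rewrite mulr_ge0 //; lra.
have : 0 <= S * (y - q.1) by rewrite mulr_ge0 //; lra.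
by lra.
Qed.

End interpolation.

(** * Probabilities as real numbers *)
Section real_probability.
Context {d : measure_display} {Om : measurableType d} {R : realType}
  (P : probability Om R).

Definition pr (A : set Om) : R := fine (P A).

Lemma prE A : measurable A -> P A = (pr A)%:E.
Proof. by move=> mA; rewrite /pr fineK // fin_num_measure. Qed.

Lemma pr_ge0 A : 0 <= pr A.
Proof. exact/fine_ge0. Qed.

Lemma prT : pr setT = 1.
Proof. by rewrite /pr probability_setT. Qed.

Lemma prU A B : measurable A -> measurable B -> A `&` B = set0 ->
  pr (A `|` B) = pr A + pr B.
Proof.
move=> mA mB AB; apply: EFin_inj; rewrite EFinD -!prE //; last exact: measurableU.
exact: measureU.
Qed.

Lemma pr_le A B : measurable A -> measurable B -> A `<=` B -> pr A <= pr B.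
Proof.
move=> mA mB AB; rewrite -lee_fin -!prE //.
by apply: le_measure; rewrite ?inE.
Qed.

Lemma pr_eq_off A B N : measurable A -> measurable B -> measurable N -> pr N = 0 ->
  (forall w, ~ N w -> A w <-> B w) -> pr A = pr B.
Proof.
suff le A' B' : measurable A' -> measurable B' -> measurable N -> pr N = 0 ->
    (forall w, ~ N w -> A' w -> B' w) -> pr A' <= pr B'.
  move=> mA mB mN N0 H; apply: le_anti.
  by rewrite !le // => w /H[].
move=> mA mB mN N0 H.
have mNB : measurable (N `\` B') by exact: measurableD.
have /eqP NB0 : pr (N `\` B') == 0.
  by rewrite eq_le pr_ge0 -N0 pr_le // => w [].
rewrite -[leRHS]addr0 -NB0 -prU //; last by apply/seteqP; split => // w [Bw [_ /(_ Bw)]].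
apply: pr_le => //; first exact: measurableU.
move=> w Aw; have [Bw|nB] := pselect (B' w); first by left.
by right; split => //; apply: contrapT => nN; apply: nB; exact: H.
Qed.

Lemma pr_null_sub A N : measurable A -> measurable N -> pr N = 0 -> A `<=` N -> pr A = 0.
Proof.
by move=> mA mN N0 AN; apply: le_anti; rewrite pr_ge0 -N0 pr_le.
Qed.

Lemma pr_nullU A B : measurable A -> measurable B -> pr A = 0 -> pr B = 0 ->
  pr (A `|` B) = 0.
Proof.
move=> mA mB A0 B0; rewrite -A0; apply: (pr_eq_off _ _ B) => //; first exact: measurableU.
by move=> w nB; split; [case|left].
Qed.

End real_probability.

Section distribution_function.
Context {R : realType} (mu : probability R R).

Definition df (x : R) : R := pr mu `]-oo, x].

Lemma df_le x y : x <= y -> df x <= df y.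
Proof.
move=> xy; apply: pr_le; try exact: measurable_itv.
by apply: subset_itvl; rewrite bnd_simp.
Qed.

Lemma pr_itv (x y : R) : x <= y -> pr mu `]x, y] = df y - df x.
Proof.
move=> xy; rewrite /df.
have -> : `]-oo, y]%classic = `]-oo, x]%classic `|` `]x, y]%classic :> set R.
  apply/seteqP; split => z /=; rewrite !in_itv /=.
    by move=> zy; case: (leP z x) => _; [left|right].
  by case => [zx|/andP[]//]; exact: le_trans xy.
rewrite prU; [by rewrite addrAC subrr add0r|exact: measurable_itv|exact: measurable_itv|].
apply/seteqP; split => // z [] /=; rewrite !in_itv /= => zx /andP[xz _].
by move: (lt_le_trans xz zx); rewrite ltxx.
Qed.

(** Without atoms, the end points of an interval are immaterial. *)
Lemma pr_between (A : set R) (x y : R) : (forall a, mu [set a] = 0%E) -> measurable A ->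
  x <= y -> `]x, y[ `<=` A -> A `<=` `[x, y] -> pr mu A = df y - df x.
Proof.
move=> atom mA xy xA Ay; rewrite -pr_itv //.
have s1 a : measurable [set a : R] by exact: measurable_set1.
have p1 a : pr mu [set a] = 0 by rewrite /pr atom.
apply: (pr_eq_off _ _ _ ([set x] `|` [set y])) => //; try exact: measurable_itv.
- exact: measurableU.
- exact: pr_nullU.
move=> w nw; have wx : w != x by apply/eqP => E; apply: nw; left.
have wy : w != y by apply/eqP => E; apply: nw; right.
split => [/Ay|] /=; rewrite !in_itv /= => /andP[A1 A2].
  by rewrite A2 andbT lt_neqAle eq_sym wx.
by apply: xA; rewrite /= in_itv /= A1 lt_neqAle wy.
Qed.

End distribution_function.

(** * Level sets of an almost everywhere increasing function *)
Section level_sets.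
Context {R : realType} (phi : R -> R) (N : set R).
Hypothesis phi_lt : forall x y, (unit_interval `\` N) x -> (unit_interval `\` N) y ->
  x < y -> phi x < phi y.

(** The point [c] is left out because [phi c] may lie on either side of [x]. *)
Definition cuts (x c : R) := forall w, (unit_interval `\` N) w -> w != c ->
  (phi w <= x) = (w <= c).

(** The cut is the supremum of the level set, to which 0 is added to cover an
    empty level set. *)
Lemma level_cut (x : R) : exists2 c, 0 <= c <= 1 & cuts x c.
Proof.
pose A : set R := [set w | w = 0 \/ (unit_interval `\` N) w /\ phi w <= x].
have A0 : A 0 by left.
have A1 : ubound A 1.
  move=> w [->|[[]]]; first exact: ler01.
  by rewrite /unit_interval /= in_itv /= => /andP[].
have hs : has_sup A by split; [exists 0|exists 1].
have s0 : 0 <= sup A by apply: ub_le_sup A0; exists 1.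
have s1 : sup A <= 1 by apply: ge_sup => //; exists 0.
exists (sup A); first by rewrite s0.
move=> w wIN wA; apply/idP/idP => [phw|].
  by apply: ub_le_sup; [exists 1|right].
rewrite le_eqVlt (negbTE wA) /= => ws.
have := sup_adherent (eps := sup A - w) _ hs; rewrite subr_gt0 => /(_ ws)[w' Aw'].
rewrite opprB addrCA subrr addr0 => ww'.
have w0 : 0 <= w by case: wIN; rewrite /unit_interval /= in_itv /= => /andP[].
case: Aw' => [w'0|[w'I px]]; first by move: ww'; rewrite w'0; lra.
exact/ltW/lt_le_trans/px/phi_lt.
Qed.

Hypothesis N0 : lebesgue_measure.-negligible N.

Lemma off_null (a b : R) : 0 <= a -> a < b -> b <= 1 ->
  exists2 w, a < w < b & (unit_interval `\` N) w.
Proof.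
move=> a0 ab b1; apply: contrapT => H.
have abN : `]a, b[ `<=` N.
  move=> w /=; rewrite in_itv /= => wab; apply: contrapT => nN; apply: H; exists w => //.
  by split => //; rewrite /unit_interval /= in_itv /=; lra.
have [A [mA A0 NA]] := N0.
have : (lebesgue_measure (`]a, b[%classic : set R) <= lebesgue_measure A)%E.
  by apply: le_measure; rewrite ?inE //; exact: subset_trans NA.
rewrite lebesgue_measure_itv /= lte_fin ab A0 -EFinB lee_fin; lra.
Qed.

(** Conversely the cut [c] is realised by the supremum of [phi] on the left of
    [c]: as the complement of [N] is dense, another point lies between [c] and
    any [w > c], which makes [phi w] strictly larger. *)
Lemma cut_level (c : R) : 0 < c < 1 -> exists x, cuts x c.
Proof.
move=> /andP[c0 c1].
pose A : set R := [set y | exists2 w, (unit_interval `\` N) w /\ w < c & y = phi w].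
have [a /andP[a0 ac] aI] := off_null 0 c (lexx _) c0 (ltW c1).
have Aa : A (phi a) by exists a.
have ubA w : (unit_interval `\` N) w -> c < w -> ubound A (phi w).
  move=> wI cw y [w' [w'I w'c] ->]; apply/ltW/phi_lt => //; exact: lt_trans cw.
have [b /andP[cb b1] bI] := off_null c 1 (ltW c0) c1 (lexx _).
have hs : has_sup A by split; [exists (phi a)|exists (phi b); exact: ubA].
exists (sup A) => w wI wc; case: (ltgtP w c) wc => // wc _.
  by apply: ub_le_sup; [case: hs|exists w].
apply/negbTE; rewrite -ltNge.
have w1 : w <= 1 by case: wI; rewrite /unit_interval /= in_itv /= => /andP[].
have [w' /andP[cw' w'w] w'I] := off_null c w (ltW c0) wc w1.
apply: (@le_lt_trans _ _ (phi w')); last exact: phi_lt.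
by apply: ge_sup; [exists (phi a)|exact: ubA].
Qed.

End level_sets.

(** * The map and the lift of its iterates *)
Section manneville_pomeau.
Context {R : realType} (s : R).
Hypotheses (hs0 : 0 < s) (hs1 : s < 1).

Let s1gt0 : 0 < 1 + s. Proof. by move: hs0; lra. Qed.
Let s1neq0 : 1 + s != 0. Proof. by rewrite lt0r_neq0. Qed.

(** The map before reduction modulo 1. *)
Definition unfolded (x : R) : R := x + x `^ (1 + s).

Lemma powR_split (x : R) : 0 <= x -> x `^ (1 + s) = x * x `^ s.
Proof.
move=> x0.
have [->|xn0] := eqVneq x 0; first by rewrite powR0 // mul0r.
by rewrite powRD ?powRr1 // xn0 implybT.
Qed.

Lemma powR_mvt (x y : R) : 0 < x -> x < y ->
  exists2 c, x < c < y & y `^ (1 + s) - x `^ (1 + s) = (1 + s) * c `^ s * (y - x).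
Proof.
move=> x0 xy.
have dv (z : R) : 0 < z -> is_derive z 1 (@powR R ^~ (1 + s)) ((1 + s) * z `^ s).
  move=> z0; have -> : (1 + s) * z `^ s = (1 + s) * z `^ (1 + s - 1).
    by congr (_ * _ `^ _); ring.
  exact: is_derive1_powR.
have [||c cxy E] := @MVT R (@powR R ^~ (1 + s)) (fun z => (1 + s) * z `^ s) x y xy.
- by move=> z; rewrite in_itv /= => /andP[xz _]; apply: dv; lra.
- apply: derivable_within_continuous => z; rewrite in_itv /= => /andP[xz _].
  by have [] := dv z (lt_le_trans x0 xz).
- by exists c => //; move: cxy; rewrite in_itv.
Qed.

Lemma powR_lt1 (x : R) : 0 <= x -> x < 1 -> x `^ (1 + s) < 1.
Proof.
move=> x0 x1; have E : (1 : R) `^ (1 + s) = 1 by rewrite powR1.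
by rewrite -[ltRHS]E; apply: gt0_ltr_powR; rewrite ?nnegrE.
Qed.

Lemma powR_ltr (r x y : R) : 0 < r -> 0 <= x -> x < y -> x `^ r < y `^ r.
Proof. by move=> r0 x0 xy; apply: gt0_ltr_powR => //; rewrite nnegrE //; lra. Qed.

Lemma powR_le1 (r x : R) : 0 < r -> 0 <= x <= 1 -> 0 <= x `^ r <= 1.
Proof.
move=> r0 /andP[x0 x1]; rewrite powR_ge0 /=.
have <- : (1 : R) `^ r = 1 by rewrite powR1.
by apply: ge0_ler_powR; rewrite ?nnegrE // ltW.
Qed.

Lemma unfolded0 : unfolded 0 = 0.
Proof. by rewrite /unfolded powR0 ?addr0. Qed.

Lemma unfolded1 : unfolded 1 = 2.
Proof. by rewrite /unfolded powR1. Qed.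

(** The bound from below holds because the map minus the identity increases,
    the one from above because its derivative is at most [2 + s]. *)
Lemma unfolded_bounds (x y : R) : 0 <= x -> x <= y -> y <= 1 ->
  y - x <= unfolded y - unfolded x <= 3 * (y - x).
Proof.
move=> x0 xy y1; rewrite /unfolded.
move: xy; rewrite le_eqVlt => /orP[/eqP->|xy]; first by lra.
have m : x `^ (1 + s) < y `^ (1 + s) by apply: powR_ltr => //; lra.
move: x0; rewrite le_eqVlt => /orP[/eqP x0|x0].
  rewrite -x0 in m xy *; rewrite (powR_split y); last lra.
  rewrite powR0 //.
  have /andP[] : 0 <= y `^ s <= 1 by apply: powR_le1 => //; lra.
  by nra.
have [c /andP[xc cy] E] := powR_mvt x y x0 xy.
have /andP[] : 0 <= c `^ s <= 1 by apply: powR_le1 => //; lra.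
move: E m; set p := c `^ s; set A := y `^ _; set B := x `^ _ => E m p0 p1.
have H : (1 + s) * p * (y - x) <= 2 * (y - x).
  by apply: ler_wpM2r; [lra|move: hs0 hs1; nra].
have : 0 < A - B by lra.
by rewrite E in H *; lra.
Qed.

(** Away from 0 the mean value theorem compares the slopes on both sides of [y];
    for [x = 0] the inequality amounts to [y `^ s < z `^ s]. *)
Lemma unfolded_convex (x y z : R) : 0 <= x -> x < y -> y < z ->
  (unfolded y - unfolded x) * (z - y) < (unfolded z - unfolded y) * (y - x).
Proof.
move=> x0 xy yz; rewrite /unfolded.
suff : (y `^ (1 + s) - x `^ (1 + s)) * (z - y) <
       (z `^ (1 + s) - y `^ (1 + s)) * (y - x) by lra.
move: x0; rewrite le_eqVlt => /orP[/eqP x0|x0].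
  rewrite -x0 in xy *; rewrite !powR_split ?lexx //; try lra.
  have H : y `^ s < z `^ s by apply: powR_ltr => //; lra.
  have : 0 < y * z by apply: mulr_gt0; lra.
  by nra.
have [c /andP[xc cy] ->] := powR_mvt x y x0 xy.
have [e /andP[ye ez] ->] := powR_mvt y z (lt_trans x0 xy) yz.
have H : c `^ s < e `^ s by apply: powR_ltr => //; lra.
set A := c `^ s in H *; set B := e `^ s in H *.
have P : 0 < (1 + s) * ((y - x) * (z - y)).
  by rewrite !mulr_gt0 ?subr_gt0.
have -> : (1 + s) * A * (y - x) * (z - y) = A * ((1 + s) * ((y - x) * (z - y))) by ring.
have -> : (1 + s) * B * (z - y) * (y - x) = B * ((1 + s) * ((y - x) * (z - y))) by ring.
by rewrite ltr_pM2r.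
Qed.

Local Notation T := (MP s).

Lemma MPE (x : R) : T x = unfolded x - (1 <= unfolded x)%R%:R.
Proof. by rewrite /MP -/(unfolded x) leNgt; case: ifP => _ /=; rewrite ?subr0. Qed.

Lemma MP1 : T 1 = 1.
Proof. by rewrite MPE unfolded1 (_ : 1 <= 2) /=; lra. Qed.

Lemma MP0 : T 0 = 0.
Proof. by rewrite MPE unfolded0 // ler10 subr0. Qed.

Lemma MP_lt1 (x : R) : 0 <= x < 1 -> 0 <= T x < 1.
Proof.
move=> /andP[x0 x1]; rewrite MPE.
have := unfolded_bounds 0 x (lexx _) x0 (ltW x1); rewrite unfolded0 // => H.
have : unfolded x < 2 by have := powR_lt1 x x0 x1; rewrite /unfolded; lra.
by case: (leP 1 (unfolded x)) => /=; lra.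
Qed.

(** The index of the node of [iter h T] that contains [x], in binary: each
    application of the map adds a digit, which tells whether the reduction
    modulo 1 takes place. The fixed point 1 gets the last node. *)
Fixpoint branch (h : nat) (x : R) : nat :=
  if h is h'.+1 then ((branch h' x).*2 + (1 <= unfolded (iter h' T x))%R)%N else 0%N.

(** Iterates of [T] have jumps from 1 to 0 at the nodes; counting the nodes
    passed turns them into a strictly increasing continuous function. *)
Definition lift (h : nat) (x : R) : R := (branch h x)%:R + iter h T x.

Lemma liftS h (x : R) : lift h.+1 x = (branch h x).*2%:R + unfolded (iter h T x).
Proof. by rewrite /lift /= MPE natrD; ring. Qed.

Lemma iter1 h : iter h T 1 = 1.
Proof. by elim: h => //= h ->; exact: MP1. Qed.

Lemma iter0 h : iter h T 0 = 0.
Proof. by elim: h => //= h ->; exact: MP0. Qed.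

Lemma iter_lt1 h (x : R) : 0 <= x < 1 -> 0 <= iter h T x < 1.
Proof. by move=> x01; elim: h => //= h IH; exact: MP_lt1. Qed.

Lemma iter_le1 h (x : R) : 0 <= x <= 1 -> 0 <= iter h T x <= 1.
Proof.
move=> /andP[x0]; rewrite le_eqVlt => /orP[/eqP->|x1].
  by rewrite iter1 ler01 lexx.
by have /andP[-> /ltW->] := iter_lt1 h x (introT andP (conj x0 x1)).
Qed.

Lemma branch_lt h (x : R) : (branch h x < 2 ^ h)%N.
Proof. by elim: h => //= h IH; rewrite expnS; case: (_ <= _)%R; lia. Qed.

(** One step multiplies increments by a factor between 1 and 3: on one branch
    this is [unfolded_bounds]; across branches the two parts meet at an integer,
    thanks to [unfolded 0 = 0] and [unfolded 1 = 2]. *)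
Lemma lift_lip h (x y : R) : 0 <= x -> x <= y -> y <= 1 ->
  y - x <= lift h y - lift h x <= 3 ^+ h * (y - x).
Proof.
move=> x0 xy y1; elim: h => [|h]; first by rewrite /lift /= expr0; lra.
rewrite !liftS /lift exprS -mulrA -!muln2 !natrM.
have /andP[u0 u1] : 0 <= iter h T x <= 1 by apply: iter_le1; lra.
have /andP[v0 v1] : 0 <= iter h T y <= 1 by apply: iter_le1; lra.
set u := iter h T x in u0 u1 *; set v := iter h T y in v0 v1 *.
set E := 3 ^+ h * _; move: (branch h x) (branch h y) => b c /andP[l1 l2].
have [bc|bc|bc] := ltngtP b c.
- have bc' : (b%:R + 1 <= c%:R :> R) by rewrite natr1 ler_nat.
  have := unfolded_bounds 0 v (lexx _) v0 v1; rewrite unfolded0 //.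
  have := unfolded_bounds u 1 u0 u1 (lexx _); rewrite unfolded1 //.
  by lra.
- have bc' : (c%:R + 1 <= b%:R :> R) by rewrite natr1 ler_nat.
  have vu : v - u = 1 /\ y = x by lra.
  have u1' : u = 0 by lra.
  have v1' : v = 1 by lra.
  by rewrite u1' v1' unfolded0 // unfolded1; lra.
- rewrite bc in l1 l2 *.
  have uv : u <= v by lra.
  by have := unfolded_bounds u v u0 uv v1; lra.
Qed.

Lemma branch0 h : branch h 0 = 0%N.
Proof. by elim: h => //= h ->; rewrite iter0 unfolded0 // ler10. Qed.

Lemma lift0 h : lift h 0 = 0.
Proof. by rewrite /lift iter0 addr0 branch0. Qed.

Lemma lift1 h : lift h 1 = 2 ^+ h.
Proof.
elim: h => [|h IH]; first by rewrite /lift /= add0r.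
rewrite liftS iter1 unfolded1 -muln2 natrM exprS -IH /lift iter1; ring.
Qed.

Lemma branch1 h : (branch h 1).+1 = (2 ^ h)%N.
Proof.
have := lift1 h; rewrite /lift iter1 -natrX natr1 => /eqP.
by rewrite eqr_nat => /eqP.
Qed.

Lemma lift_lt h (x y : R) : 0 <= x -> x < y -> y <= 1 -> lift h x < lift h y.
Proof. by move=> x0 xy y1; have := lift_lip h x y x0 (ltW xy) y1; lra. Qed.

Lemma lift_le h (x y : R) : 0 <= x -> x <= y -> y <= 1 -> lift h x <= lift h y.
Proof. by move=> x0 xy y1; have := lift_lip h x y x0 xy y1; lra. Qed.

Lemma lift_leE h (x y : R) : 0 <= x <= 1 -> 0 <= y <= 1 -> (lift h x <= lift h y) = (x <= y).
Proof.
move=> /andP[x0 x1] /andP[y0 y1]; case: (leP x y) => xy.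
  by rewrite lift_le.
by apply/negbTE; rewrite -ltNge lift_lt.
Qed.

Lemma branchP h (x : R) k : 0 <= x < 1 -> (branch h x == k) = (k%:R <= lift h x < k%:R + 1).
Proof.
move=> x01; have /andP[t0 t1] := iter_lt1 h x x01.
rewrite /lift; move: (branch h x) => b.
have [->|] := eqVneq b k; first by apply/esym/andP; split; lra.
move=> bk; apply/esym/negbTE/negP => /andP[A B].
have : (b%:R < k%:R + 1 :> R) by lra.
have : (k%:R < b%:R + 1 :> R) by lra.
rewrite !natr1 !ltr_nat; lia.
Qed.

Lemma branch_le h (x y : R) : 0 <= x -> x <= y -> y <= 1 -> (branch h x <= branch h y)%N.
Proof.
move=> x0 xy y1; move: (xy); rewrite le_eqVlt => /orP[/eqP->//|xy'].
have := lift_le h x y x0 xy y1; rewrite leqNgt; apply: contraTN => b.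
rewrite -ltNge /lift.
have /andP[t0 t1] : 0 <= iter h T x < 1 by apply: iter_lt1; lra.
have /andP[t2 t3] : 0 <= iter h T y <= 1 by apply: iter_le1; lra.
have : ((branch h y)%:R + 1 <= (branch h x)%:R :> R) by rewrite natr1 ler_nat.
have [y1'|y1'] := eqVneq y 1.
  by have := branch_lt h x; rewrite -(branch1 h) ltnS leqNgt -y1' b.
have /andP[_ t4] : 0 <= iter h T y < 1.
  by apply: iter_lt1; rewrite lt_neqAle y1' y1 (le_trans x0 xy).
by lra.
Qed.

(** Slopes multiply under composition: if the slopes [a / X <= b / Z] of the
    inner function and [A / a < B / b] of the outer one increase, so do the
    slopes [A / X] and [B / Z] of the composite. *)
Lemma slope_comp (a b A B X Z : R) : 0 < a -> 0 <= A -> 0 < X ->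
  a * Z <= b * X -> A * b < B * a -> A * Z < B * X.
Proof.
move=> a0 A0 X0 H1 H2; rewrite -(ltr_pM2l a0).
apply: (@le_lt_trans _ _ (A * b * X)).
  by rewrite mulrCA -[leRHS]mulrA; apply: ler_wpM2l.
by rewrite mulrA (mulrC a) ltr_pM2r.
Qed.

(** Each branch of [iter h T] is strictly convex, as a composite of increasing
    convex functions at least one of which is strictly convex. *)
Lemma lift_convex h (x y z : R) : (0 < h)%N -> 0 <= x -> x < y -> y < z -> z <= 1 ->
  branch h x = branch h z ->
  (iter h T y - iter h T x) * (z - y) < (iter h T z - iter h T y) * (y - x).
Proof.
case: h => // h _ x0 xy yz z1.
have A k : branch k x = branch k z -> branch k y = branch k z.
  move=> E; apply/eqP; rewrite eqn_leq -{2}E !branch_le //; lra.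
have lt k : branch k x = branch k z ->
    0 <= iter k T x < iter k T y /\ iter k T y < iter k T z.
  move=> E; have : lift k x < lift k y by apply: lift_lt; lra.
  have : lift k y < lift k z by apply: lift_lt; lra.
  rewrite /lift E A //.
  have /andP[] : 0 <= iter k T x <= 1 by apply: iter_le1; lra.
  by split; lra.
have half k : branch k.+1 x = branch k.+1 z -> branch k x = branch k z.
  by move=> /=; do 2!case: (_ <= _)%R; lia.
have step k : (iter k T y - iter k T x) * (z - y) <=
    (iter k T z - iter k T y) * (y - x) ->
  branch k.+1 x = branch k.+1 z ->
  (iter k.+1 T y - iter k.+1 T x) * (z - y) < (iter k.+1 T z - iter k.+1 T y) * (y - x).
  move=> le E'; have E := half _ E'; have [/andP[u0 uv] vw] := lt _ E.
  have Ey := A _ E'; move: E' Ey; rewrite /= !(MPE (iter k T _)) E (A _ E).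
  move=> /addnI -> /addnI ->.
  have C := unfolded_convex _ _ _ u0 uv vw.
  have D : unfolded (iter k T x) <= unfolded (iter k T y).
    have := unfolded_bounds _ _ u0 (ltW uv); have : iter k T y <= 1; last by lra.
    by have /andP[] : 0 <= iter k T y <= 1 by apply: iter_le1; lra.
  rewrite !opprB !addrA !subrK.
  by apply: slope_comp le C; lra.
elim: h => [|h IH] E; apply: (step _ _ E); first by rewrite /=; lra.
by apply: ltW; apply: IH; exact: half.
Qed.

Lemma lift_ucont h : ucont (lift h).
Proof.
apply: (@lipschitz_ucont _ (3 ^+ h)); first by rewrite exprn_ge0.
move=> x y x0 xy y1; have := lift_lip h x y x0 xy y1.
by rewrite ler_norml; lra.
Qed.

Definition lift_inv h (p : R) := xget 0 [set x : R | 0 <= x <= 1 /\ lift h x = p].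

Lemma lift_invP h (p : R) : 0 <= p <= 2 ^+ h ->
  0 <= lift_inv h p <= 1 /\ lift h (lift_inv h p) = p.
Proof.
move=> p01; have [|x x01 xp] := @ucont_ivt _ (lift h) p (lift_ucont h).
  by rewrite lift0 lift1.
by have : [set x : R | 0 <= x <= 1 /\ lift h x = p] (lift_inv h p) by exact: (xgetI 0 (x := x)).
Qed.

Lemma lift_inv_lip h (p q : R) : 0 <= p -> p <= q -> q <= 2 ^+ h ->
  0 <= lift_inv h q - lift_inv h p <= q - p.
Proof.
move=> p0 pq q1; have [|a01 ap] := lift_invP h p; first by rewrite p0 (le_trans pq).
have [|b01 bq] := lift_invP h q; first by rewrite q1 (le_trans p0).
have ab : lift_inv h p <= lift_inv h q by rewrite -(lift_leE h) // ap bq.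
have := lift_lip h (lift_inv h p) (lift_inv h q); rewrite ap bq.
by lra.
Qed.

Lemma lift_inv_leE h (p x : R) : 0 <= p <= 2 ^+ h -> 0 <= x <= 1 ->
  (lift_inv h p <= x) = (p <= lift h x).
Proof. by move=> /lift_invP[a01 ap] x01; rewrite -[in RHS]ap lift_leE. Qed.

Lemma lift_inv_geE h (p x : R) : 0 <= p <= 2 ^+ h -> 0 <= x <= 1 ->
  (x <= lift_inv h p) = (lift h x <= p).
Proof. by move=> /lift_invP[a01 ap] x01; rewrite -[in RHS]ap lift_leE. Qed.

(** The inverse of the k-th branch is [y |-> lift_inv h (k%:R + y)], whose value
    at 0 is the left end of the node. *)
Definition node h (k : nat) : R := lift_inv h k%:R.

Lemma node_itv h k (y : R) : (k < 2 ^ h)%N -> 0 <= y <= 1 -> 0 <= k%:R + y <= 2 ^+ h.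
Proof.
move=> k2 /andP[y0 y1]; rewrite addr_ge0 //= -natrX.
have : (k%:R + 1 <= (2 ^ h)%:R :> R) by rewrite natr1 ler_nat.
by lra.
Qed.

Lemma node_itv0 h k : (k <= 2 ^ h)%N -> 0 <= (k%:R : R) <= 2 ^+ h.
Proof. by move=> k2; rewrite ler0n -natrX ler_nat. Qed.

Lemma node_le h i j : (i <= j)%N -> (j <= 2 ^ h)%N -> node h i <= node h j.
Proof.
move=> ij j2; rewrite /node.
have : (i%:R <= j%:R :> R) by rewrite ler_nat.
have /andP[_ j2'] := node_itv0 h j j2.
by move=> ij'; have := lift_inv_lip h i%:R j%:R (ler0n _ _) ij' j2'; lra.
Qed.

Lemma node0 h : node h 0 = 0.
Proof.
have [|a01 a] := lift_invP h 0; first by rewrite lexx exprn_ge0.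
apply/eqP; rewrite eq_le -{1}(lift_leE h) // ?lexx ?ler01 // a lift0 lexx /=.
by rewrite /node; case/andP: a01.
Qed.

Lemma node_last h : node h (2 ^ h) = 1.
Proof.
have [|a01 a] := lift_invP h (2 ^+ h); first by rewrite lexx exprn_ge0.
rewrite /node natrX; apply/eqP; rewrite eq_le -[X in _ && X](lift_leE h) //.
  by rewrite a lift1 lexx /=; case/andP: a01 => _ ->.
by rewrite lexx ler01.
Qed.

(** * Approximate nodes and branch inverses on a fine partition *)
Section grid.
Context (h : nat) (hh : (0 < h)%N) (Z : nat -> seq R) (hZ : refining_partitions Z).
Context (m : nat) (m2 : (2 <= m)%N).

Definition mesh := \big[Num.max/0]_(1 <= i < m) (zpt Z m i.+1 - zpt Z m i).

(** The lift then grows by less than [1 / 2] from one partition point to the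
    next, and crosses at most one integer. *)
Context (small_mesh : 3 ^+ h * mesh < 1 / 2).

Local Notation z := (zpt Z m).
Local Notation dp := (dpt s h Z m).
Local Notation an := (anode s h Z m).
Local Notation bi := (branch_inv s h Z m).

Lemma z_first : z 1 = 0. Proof. exact: partition_first. Qed.
Lemma z_last : z m = 1. Proof. exact: partition_last. Qed.

Lemma z_lt i j : (0 < i)%N -> (i < j)%N -> (j <= m)%N -> z i < z j.
Proof.
case: i => // i _; case: j => // j ij jm; rewrite /zpt /=.
have ss := partition_sorted hZ m2; have sz := partition_size hZ m2.
by apply: (sorted_ltn_nth (@lt_trans _ R) 0 ss) => //; rewrite inE sz //; olia.
Qed.

Lemma z_le i j : (0 < i)%N -> (i <= j)%N -> (j <= m)%N -> z i <= z j.
Proof.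
move=> i0; rewrite leq_eqVlt => /orP[/eqP->//|ij] jm.
exact/ltW/z_lt.
Qed.

Lemma z_itv j : (0 < j)%N -> (j <= m)%N -> 0 <= z j <= 1.
Proof. by move=> j0 jm; rewrite -z_first -z_last !z_le. Qed.

Lemma z_itv1 j : (0 < j)%N -> (j < m)%N -> 0 <= z j < 1.
Proof. by move=> j0 jm; rewrite -z_first -z_last z_lt ?z_le // ltnW. Qed.

Lemma z_step j : (0 < j)%N -> (j < m)%N -> z j.+1 - z j <= mesh.
Proof.
move=> j0 jm; rewrite /mesh.
apply: (Order.TotalTheory.le_bigmax_seq 0 j xpredT (fun i => z i.+1 - z i)) => //.
by rewrite mem_index_iota j0.
Qed.

Lemma mesh_ge0 : 0 <= mesh.
Proof. exact: bigmax_ge_id. Qed.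

Lemma lift_step j : (0 < j)%N -> (j < m)%N -> lift h (z j.+1) - lift h (z j) < 1 / 2.
Proof.
move=> j0 jm; have /andP[a0 a1] := z_itv j j0 (ltnW jm); have /andP[b0 b1] := z_itv j.+1 isT jm.
have := lift_lip h (z j) (z j.+1) a0 (z_le _ _ j0 (leqnSn _) jm) b1.
have : 3 ^+ h * (z j.+1 - z j) <= 3 ^+ h * mesh.
  by apply: ler_wpM2l; [rewrite exprn_ge0|exact: z_step].
by move: small_mesh; lra.
Qed.

Lemma branch_step j : (0 < j)%N -> (j < m)%N ->
  branch h (z j.+1) = branch h (z j) \/ branch h (z j.+1) = (branch h (z j)).+1.
Proof.
move=> j0 jm; have st := lift_step j j0 jm.
have /andP[_ t1] := iter_lt1 h _ (z_itv1 j j0 jm).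
have /andP[t0 _] := iter_le1 h _ (z_itv j.+1 isT jm).
have /andP[a0 _] := z_itv j j0 (ltnW jm); have /andP[_ b1] := z_itv j.+1 isT jm.
have B := branch_le h _ _ a0 (z_le _ _ j0 (leqnSn _) jm) b1.
have : (branch h (z j.+1))%:R < (branch h (z j)).+2%:R :> R.
  have -> : (branch h (z j)).+2%:R = (branch h (z j))%:R + 2 :> R by rewrite -addn2 natrD.
  by move: st; rewrite /lift; lra.
by rewrite ltr_nat; olia.
Qed.

Lemma descent_branch j : (0 < j)%N -> (j < m)%N ->
  (iter h T (z j.+1) < iter h T (z j)) = (branch h (z j) < branch h (z j.+1))%N.
Proof.
move=> j0 jm; have st := lift_step j j0 jm.
have /andP[a0 _] := z_itv j j0 (ltnW jm); have /andP[_ b1] := z_itv j.+1 isT jm.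
have := lift_le h _ _ a0 (z_le _ _ j0 (leqnSn _) jm) b1; move: st; rewrite /lift.
have [->|->] := branch_step j j0 jm; first by rewrite ltnn => _; lra.
by rewrite ltnSn -natr1; lra.
Qed.

(** The places where a counter increases by one, in order: the k-th one leads
    from the value [k] to the value [k + 1]. *)
Lemma jumps (b : nat -> nat) l : b 1%N = 0%N ->
  (forall j, (0 < j <= l)%N -> b j.+1 = b j \/ b j.+1 = (b j).+1) ->
  let D := [seq i <- iota 1 l | (b i < b i.+1)%N] in
  size D = b l.+1 /\
  forall k, (k < b l.+1)%N ->
    [/\ (0 < nth 0%N D k)%N, (nth 0%N D k <= l)%N,
        b (nth 0%N D k) = k & b (nth 0%N D k).+1 = k.+1].
Proof.
move=> b1; elim: l => [|l IH] H; first by rewrite /= b1.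
have [|sz nt] := IH; first by move=> j /andP[j0 jl]; apply: H; rewrite j0 ltnW.
rewrite -[X in iota 1 X]addn1 iotaD cats1 filter_rcons add1n /=.
have nt' k : (k < b l.+1)%N -> let D := [seq i <- iota 1 l | (b i < b i.+1)%N] in
    [/\ (0 < nth 0%N D k)%N, (nth 0%N D k <= l.+1)%N,
        b (nth 0%N D k) = k & b (nth 0%N D k).+1 = k.+1].
  by move=> /nt[? ? ? ?]; split=> //; exact: leqW.
have [E|E] := H l.+1 (leqnn _); rewrite E ?ltnn ?ltnSn; first by split => //; rewrite -E.
rewrite size_rcons sz; split=> // k kl; rewrite nth_rcons sz.
move: kl; rewrite ltnS leq_eqVlt => /orP[/eqP->|kl]; last by rewrite kl; exact: nt'.
by rewrite ltnn eqxx; split.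
Qed.

Lemma descentsE : descents s h Z m =
  [seq i <- iota 1 m.-1 | (branch h (z i) < branch h (z i.+1))%N].
Proof.
apply: eq_in_filter => j; rewrite mem_iota => /andP[j0 jm].
by apply: descent_branch => //; olia.
Qed.

Lemma branch_z_last : (branch h (z m)).+1 = (2 ^ h)%N.
Proof. by rewrite z_last branch1. Qed.

Lemma branch_z_first : branch h (z 1) = 0%N.
Proof. by rewrite z_first branch0. Qed.

Lemma descents_spec : size (descents s h Z m) = (2 ^ h).-1 /\
  forall k, (k < (2 ^ h).-1)%N ->
    let j := nth 0%N (descents s h Z m) k in
    [/\ (0 < j)%N, (j < m)%N, branch h (z j) = k & branch h (z j.+1) = k.+1].
Proof.
have [|] := jumps (fun j => branch h (z j)) m.-1 branch_z_first.
  by move=> j /andP[j0 jm]; apply: branch_step => //; olia.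
rewrite -descentsE prednK; last by olia.
rewrite -branch_z_last /= => -> H; split => // k /H[? ? ? ?]; split => //; olia.
Qed.

Lemma dpt_last : dp (2 ^ h) = m.
Proof.
have [sz _] := descents_spec; have p : (0 < 2 ^ h)%N by rewrite expn_gt0.
by rewrite /dpt -(prednK p) /= nth_rcons sz ltnn eqxx.
Qed.

(** The index [dpt i] is the last partition point before the i-th node. *)
Lemma dpt_spec i : (0 < i < 2 ^ h)%N ->
  [/\ (0 < dp i)%N, (dp i < m)%N, branch h (z (dp i)) = i.-1 & branch h (z (dp i).+1) = i].
Proof.
case: i => // i /andP[_ i2]; have [sz H] := descents_spec.
have i2' : (i < (2 ^ h).-1)%N by olia.
by rewrite /dpt /= nth_rcons sz i2'; exact: H.
Qed.

(** The zero of the affine interpolation of [M - 1] and [N - 1] lies between the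
    two abscissae whichever of the two values is negative. *)
Lemma crossing_itv (a b M N : R) : a <= b -> (M < 1 <= N) || (N < 1 <= M) ->
  a <= a + (b - a) / (N - M) * (1 - M) <= b.
Proof.
move=> ab MN; rewrite -mulrA (mulrC _ (1 - M)).
suff /andP[r0 r1] : 0 <= (1 - M) / (N - M) <= 1.
  by move: (_ / _) r0 r1 => r r0 r1; nra.
case/orP: MN => /andP[A B].
  by rewrite divr_ge0 ?ler_pdivrMr //; lra.
have -> : (1 - M) / (N - M) = (M - 1) / (M - N) by rewrite -[RHS]mulrNN -invrN !opprB.
by rewrite divr_ge0 ?ler_pdivrMr //; lra.
Qed.

Lemma anode0 : an 0 = 0. Proof. by []. Qed.

Lemma anode_last : an (2 ^ h) = 1.
Proof. by rewrite /anode eqxx; case: eqP => // /eqP; rewrite expn_eq0. Qed.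

(** The last binary digit of [branch h] tells on which side of 1 [MPstar] lies.
    As [branch h] goes from [i - 1] to [i], this digit changes. *)
Lemma anode_bounds i : (0 < i < 2 ^ h)%N -> z (dp i) <= an i <= z (dp i).+1.
Proof.
move=> i2; have [d0 dm b0 b1] := dpt_spec i i2; case/andP: i2 => i0 i2.
rewrite /anode gtn_eqF // ltn_eqF //; apply: crossing_itv; first exact: z_le.
have hE x : branch h x = ((branch h.-1 x).*2 + (1 <= unfolded (iter h.-1 T x))%R)%N.
  by rewrite -{1}(prednK hh).
move: b0 b1; rewrite !hE /MPstar -/(unfolded _) -/(unfolded _).
by do 2!case: leP => _ //=; move: i0; clear; lia.
Qed.

Lemma node_bounds i : (0 < i < 2 ^ h)%N -> z (dp i) <= node h i <= z (dp i).+1.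
Proof.
move=> i2; have [d0 dm b0 b1] := dpt_spec i i2; case/andP: i2 => i0 i2.
have v := node_itv0 h i (ltnW i2); rewrite /node.
rewrite lift_inv_geE // ?lift_inv_leE // ?z_itv // 1?ltnW // /lift b0 b1.
have /andP[_ t1] := iter_le1 h _ (z_itv _ d0 (ltnW dm)).
have /andP[t0 _] := iter_le1 h _ (z_itv (dp i).+1 isT dm).
have : (i.-1%:R + 1 = i%:R :> R) by rewrite natr1 prednK.
by lra.
Qed.

Lemma anode_near i : (i <= 2 ^ h)%N -> `|an i - node h i| <= mesh.
Proof.
move=> i2; have := mesh_ge0.
have [->|i0] := posnP i; first by rewrite node0 subrr normr0.
move: i2; rewrite leq_eqVlt => /orP[/eqP->|i2].
  by rewrite anode_last node_last subrr normr0.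
have i02 : (0 < i < 2 ^ h)%N by rewrite i0.
have [d0 dm _ _] := dpt_spec i i02; have := z_step _ d0 dm.
by have := anode_bounds i i02; have := node_bounds i i02; rewrite ler_norml; lra.
Qed.

(** At both ends of a node the exact and the approximate end points belong to
    the same step of the partition; at 0 and 1 all of them coincide. *)
Lemma block_left i : (i < 2 ^ h)%N ->
  [/\ an i <= z (dp i).+1, node h i <= z (dp i).+1,
      z (dp i).+1 - mesh <= an i & z (dp i).+1 - mesh <= node h i].
Proof.
move=> i2; have := mesh_ge0.
have [->|i0] := posnP i; first have -> : z (dp 0).+1 = 0 by exact: z_first.
  by rewrite node0 anode0; split; lra.
have i02 : (0 < i < 2 ^ h)%N by rewrite i0.
have [d0 dm _ _] := dpt_spec i i02; have := z_step _ d0 dm.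
by have := anode_bounds i i02; have := node_bounds i i02; split; lra.
Qed.

Lemma block_right i : (i < 2 ^ h)%N ->
  [/\ z (dp i.+1) <= an i.+1, z (dp i.+1) <= node h i.+1,
      an i.+1 <= z (dp i.+1) + mesh & node h i.+1 <= z (dp i.+1) + mesh].
Proof.
have := mesh_ge0; rewrite leq_eqVlt => ? /orP[/eqP->|i2].
  by rewrite dpt_last z_last anode_last node_last; split; lra.
have [d0 dm _ _] := dpt_spec i.+1 i2; have := z_step _ d0 dm.
by have := anode_bounds i.+1 i2; have := node_bounds i.+1 i2; split; lra.
Qed.

Lemma dpt_next i : (i < 2 ^ h)%N ->
  [/\ branch h (z (dp i).+1) = i, branch h (z (dp i.+1)) = i,
      ((dp i).+1 <= dp i.+1)%N & (dp i.+1 <= m)%N].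
Proof.
move=> i2.
have E1 : [/\ branch h (z (dp i).+1) = i, ((dp i).+1 <= m)%N &
   (0 < dp i)%N -> branch h (z (dp i)) = i.-1].
  have [->|i0] := posnP i; first by rewrite branch_z_first; split => //; exact: ltnW.
  by have [|d0 dm b0 b1] := dpt_spec i; first by rewrite i0.
have E2 : branch h (z (dp i.+1)) = i /\ (0 < dp i.+1 <= m)%N.
  move: i2; rewrite leq_eqVlt => /orP[/eqP E|i2].
    by rewrite E dpt_last; move: branch_z_last; rewrite -E => -[->]; split => //; olia.
  by have [d0 dm b0 b1] := dpt_spec i.+1 i2; split => //; olia.
case: E1 E2 => b1 dm b0 [b2 /andP[d0' dm']]; split => //.
rewrite leqNgt; apply/negP => lt.
have d0 : (0 < dp i)%N by olia.
have i0 : (0 < i)%N by case: (i) d0.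
have := branch_le h (z (dp i.+1)) (z (dp i)).
rewrite b2 b0 // z_le ?z_itv //; last by olia.
have /andP[-> _] := z_itv _ d0' dm'; have /andP[_ ->] := z_itv _ d0 (ltnW dm).
by move=> /(_ isT isT isT); olia.
Qed.

Lemma block_branch i j : (i < 2 ^ h)%N -> (dp i < j)%N -> (j <= dp i.+1)%N ->
  branch h (z j) = i.
Proof.
move=> i2 ij ji; have [b1 b2 d1 d2] := dpt_next i i2.
have jm := leq_trans ji d2; have j0 : (0 < j)%N by olia.
have /andP[c0 c1] := z_itv _ j0 jm.
have /andP[p0 _] := z_itv (dp i).+1 isT (leq_trans d1 d2).
have /andP[_ p1] : 0 <= z (dp i.+1) <= 1 by apply: z_itv => //; olia.
have A : (branch h (z (dp i).+1) <= branch h (z j))%N.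
  by apply: branch_le => //; apply: z_le => //; olia.
have B : (branch h (z j) <= branch h (z (dp i.+1)))%N.
  by apply: branch_le => //; apply: z_le => //; olia.
by rewrite b1 in A; rewrite b2 in B; apply/eqP; rewrite eqn_leq A B.
Qed.

Lemma path_grid (U : Type) (e : rel U) (p q : U) (f : nat -> U) a n : e p (f a) ->
  (forall j, (a <= j < a + n)%N -> e (f j) (f j.+1)) -> e (f (a + n)%N) q ->
  path e p (rcons [seq f j | j <- iota a n.+1] q).
Proof.
elim: n p a => [|n IH] p a ep ef eq; first by rewrite /= ep -[a]addn0 eq.
rewrite [iota _ _]/= map_cons rcons_cons; apply/andP; split => //.
apply: IH; rewrite ?addSnnS //; first by apply: ef; olia.
by move=> j aj; apply: ef; olia.
Qed.

(** A point of the graph of the inverse branch over a partition point. *)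
Definition gpt j : R * R := (iter h T (z j), z j).

Lemma branch_invE i : (i < 2 ^ h)%N -> exists2 n, ((dp i).+1 + n = dp i.+1)%N &
  bi i = interpolation ((0, an i) :: rcons [seq gpt j | j <- iota (dp i).+1 n.+1] (1, an i.+1)).
Proof.
move=> i2; have [_ _ d1 _] := dpt_next i i2.
exists (dp i.+1 - (dp i).+1)%N; first by rewrite subnKC.
by rewrite /branch_inv /index_iota subSn.
Qed.

(** Besides the ordinary segments there are a first and a last one, which end at
    approximate nodes. *)
Lemma branch_inv_locate i (y : R) : (i < 2 ^ h)%N -> 0 <= y <= 1 ->
  [\/ exists j, [/\ (dp i < j < dp i.+1)%N,
         iter h T (z j) <= y < iter h T (z j.+1) & bi i y = chord (gpt j) (gpt j.+1) y],
     0 <= y < iter h T (z (dp i).+1) /\ bi i y = chord (0, an i) (gpt (dp i).+1) y,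
     iter h T (z (dp i.+1)) <= y < 1 /\ bi i y = chord (gpt (dp i.+1)) (1, an i.+1) y |
     y = 1 /\ bi i y = an i.+1].
Proof.
move=> i2 /andP[y0 y1]; have [n nE ->] := branch_invE i i2.
pose e (p q : R * R) : bool := `[< [\/ exists2 j, (dp i < j < dp i.+1)%N & p = gpt j /\ q = gpt j.+1,
   p = (0, an i) /\ q = gpt (dp i).+1 | p = gpt (dp i.+1) /\ q = (1, an i.+1)] >].
have pe : path e (0, an i) (rcons [seq gpt j | j <- iota (dp i).+1 n.+1] (1, an i.+1)).
  apply: path_grid; first by apply/asboolP; constructor 2.
    by move=> j jn; apply/asboolP; constructor 1; exists j => //; olia.
  by apply/asboolP; constructor 3; rewrite nE.
have [[q [r [/asboolP eqr yqr E]]]|[]] := interpolation_locate e _ _ y pe y0; last first.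
  by rewrite last_rcons /= => y1' E; constructor 4; split => //; apply: le_anti; rewrite y1 y1'.
case: eqr yqr E => [[j ji [-> ->]]|[-> ->]|[-> ->]] yqr E.
- by constructor 1; exists j.
- by constructor 2.
- by constructor 3.
Qed.

Lemma branch_inv_ucont i : (i < 2 ^ h)%N -> ucont (bi i).
Proof.
move=> i2; have [n nE E] := branch_invE i i2.
have [b1 b2 d1 d2] := dpt_next i i2.
have zb j : (dp i < j <= dp i.+1)%N -> 0 <= iter h T (z j) <= 1.
  by move=> ji; apply/iter_le1/z_itv; olia.
have [a1 a2 _ _] := block_left i i2; have [a3 a4 _ _] := block_right i i2.
have step j : ((dp i).+1 <= j < (dp i).+1 + n)%N -> step_le (gpt j) (gpt j.+1).
  move=> jn; rewrite /step_le /= z_le //=; [|olia|olia].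
  rewrite andbT orbC -implyNb; apply/implyP => _.
  have : lift h (z j) < lift h (z j.+1).
    have /andP[? ?] : 0 <= z j <= 1 by apply: z_itv; olia.
    have /andP[? ?] : 0 <= z j.+1 <= 1 by apply: z_itv; olia.
    by apply: lift_lt => //; apply: z_lt; olia.
  have Bj : branch h (z j) = i by apply: block_branch => //; olia.
  have Bj' : branch h (z j.+1) = i by apply: block_branch => //; olia.
  by rewrite /lift Bj Bj'; lra.
have last_step : step_le (gpt ((dp i).+1 + n)) (1, an i.+1).
  rewrite nE /step_le /=; have /andP[t0 t1] := zb (dp i.+1) (introT andP (conj d1 (leqnn _))).
  move: t1; rewrite le_eqVlt => /orP[/eqP t1|->]; last by rewrite a3.
  apply/orP; right; apply/eqP; rewrite /gpt t1; congr (_, _).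
  have z1 : z (dp i.+1) = 1.
    apply/eqP; rewrite eq_le; have /andP[p0 ->] : 0 <= z (dp i.+1) <= 1 by apply: z_itv; olia.
    rewrite leNgt; apply/negP => lt1.
    by have := iter_lt1 h (z (dp i.+1)); rewrite p0 lt1 t1 ltxx andbF => /(_ isT).
  move: a3; rewrite z1 => a3.
  have : an i.+1 <= 1.
    move: (i2); rewrite leq_eqVlt => /orP[/eqP->|i2']; first by rewrite anode_last.
    have [d0 dm _ _] := dpt_spec i.+1 i2'; have /andP[_] := anode_bounds i.+1 i2'.
    by have := z_itv (dp i.+1).+1 isT dm; lra.
  by move=> ?; apply: le_anti; rewrite a3.
suff [K K0 HK] : exists2 K : R, 0 <= K & forall x y : R, 0 <= x -> x <= y ->
    0 <= bi i y - bi i x <= K * (y - x).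
  apply: (@lipschitz_ucont _ K) => // x y x0 xy _.
  by have := HK x y x0 xy; rewrite ler_norml; lra.
(* When the i-th node is itself a partition point, the first two points of the
   interpolation share the abscissa 0 but possibly not the ordinate; the first
   one is then never used. *)
have /andP[t0 _] := zb (dp i).+1 ltac:(olia).
move: t0; rewrite le_eqVlt => /orP[/eqP t0|t0]; last first.
  rewrite E; apply: (interpolation_lipschitz (0, an i)).
  by apply: path_grid => //; rewrite /step_le /= t0 a1.
have [|K K0 HK] := interpolation_lipschitz (gpt (dp i).+1)
    (rcons [seq gpt j | j <- iota (dp i).+2 n] (1, an i.+1)).
  have := path_grid _ step_le (gpt (dp i).+1) (1, an i.+1) gpt (dp i).+1 n.
  by rewrite /step_le eqxx orbT => /(_ isT step last_step) /= /andP[].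
exists K => // x y x0 xy; have := HK x y; rewrite -[(gpt _).1]t0 => /(_ x0 xy).
have x0n : x < 0 = false by rewrite ltNge x0.
have y0n : y < 0 = false by rewrite ltNge (le_trans x0 xy).
by rewrite E /= -t0 x0n y0n !andbF.
Qed.

(** On each segment the interpolated and the exact inverse take values between
    the same two consecutive partition points. *)
Lemma branch_inv_spec i (y : R) : (i < 2 ^ h)%N -> 0 <= y <= 1 ->
  an i <= bi i y <= an i.+1 /\ `|bi i y - lift_inv h (i%:R + y)| <= mesh.
Proof.
move=> i2 y01; have v := node_itv h i y i2 y01.
have [b1 b2 d1 d2] := dpt_next i i2; have M0 := mesh_ge0.
have [a1 a2 a3 a4] := block_left i i2; have [a5 a6 a7 a8] := block_right i i2.
have zi j : (dp i < j <= dp i.+1)%N -> 0 <= z j <= 1 by move=> ji; apply: z_itv; olia.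
have zl : z (dp i).+1 <= z (dp i.+1) by apply: z_le.
have zi1 := zi (dp i).+1 ltac:(olia); have zi2 := zi (dp i.+1) ltac:(olia).
have left_le : node h i <= lift_inv h (i%:R + y).
  have := lift_inv_lip h i%:R (i%:R + y) (ler0n _ _); rewrite /node.
  by move: y01 v; lra.
have right_le : lift_inv h (i%:R + y) <= node h i.+1.
  have /andP[_ u] := node_itv0 h i.+1 i2.
  have := lift_inv_lip h (i%:R + y) i.+1%:R; rewrite /node.
  by move: u; rewrite -natr1; move: y01 v; lra.
case: (branch_inv_locate i y i2 y01).
- move=> [j [/andP[ij ji] yj ->]].
  have jb : branch h (z j) = i by apply: block_branch => //; olia.
  have jb' : branch h (z j.+1) = i by apply: block_branch => //; olia.
  have := chord_between (gpt j) (gpt j.+1) y yj; rewrite /=.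
  have zz : z j.+1 - z j <= mesh by apply: z_step; olia.
  have zz1 : z j <= z j.+1 by apply: z_le; olia.
  have z1 : z (dp i).+1 <= z j by apply: z_le; olia.
  have z2 : z j.+1 <= z (dp i.+1) by apply: z_le; olia.
  move=> /(_ zz1) c.
  have : z j <= lift_inv h (i%:R + y).
    by rewrite lift_inv_geE ?zi //; [rewrite /lift jb; lra|olia].
  have : lift_inv h (i%:R + y) <= z j.+1.
    by rewrite lift_inv_leE ?zi //; [rewrite /lift jb'; lra|olia].
  by rewrite ler_norml; lra.
- move=> [yj ->].
  have := chord_between (0, an i) (gpt (dp i).+1) y yj a1; rewrite /=.
  have : lift_inv h (i%:R + y) <= z (dp i).+1.
    by rewrite lift_inv_leE // /lift b1; lra.
  by rewrite ler_norml; lra.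
- move=> [yj ->].
  have := chord_between (gpt (dp i.+1)) (1, an i.+1) y yj a5; rewrite /=.
  have : z (dp i.+1) <= lift_inv h (i%:R + y).
    by rewrite lift_inv_geE // /lift b2; lra.
  by rewrite ler_norml; lra.
- move=> [-> ->]; rewrite natr1.
  have := anode_near i.+1 i2; rewrite /node; lra.
Qed.

(** By strict convexity the graph of the branch lies strictly below its chords,
    hence the interpolated inverse strictly below the exact one, except at the
    partition points where they agree. *)
Lemma branch_inv_hit i (x : R) : (i < 2 ^ h)%N -> z (dp i).+1 <= x < z (dp i.+1) ->
  (x <= bi i (iter h T x)) = (x \in Z m).
Proof.
move=> i2 /andP[zx xz].
have [b1 b2 d1 d2] := dpt_next i i2.
have zi j : (dp i < j <= dp i.+1)%N -> 0 <= z j <= 1 by move=> ji; apply: z_itv; olia.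
have zi1 := zi (dp i).+1 ltac:(olia); have zi2 := zi (dp i.+1) ltac:(olia).
have x01 : 0 <= x < 1 by lra.
have xb : branch h x = i.
  have A : (branch h x <= branch h (z (dp i.+1)))%N by apply: branch_le; lra.
  have B : (branch h (z (dp i).+1) <= branch h x)%N by apply: branch_le; lra.
  by rewrite b2 in A; rewrite b1 in B; apply/eqP; rewrite eqn_leq A B.
have lx : lift h x = i%:R + iter h T x by rewrite /lift xb.
have := iter_lt1 h x x01 => tx.
case: (branch_inv_locate i (iter h T x) i2); first by lra.
- move=> [j [/andP[ij ji] yj ->]].
  have jb : branch h (z j) = i by apply: block_branch => //; olia.
  have jb' : branch h (z j.+1) = i by apply: block_branch => //; olia.
  have zj := zi j ltac:(olia); have zj' := zi j.+1 ltac:(olia).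
  have zx' : z j <= x by rewrite -(lift_leE h) //; [rewrite lx /lift jb; lra|lra].
  have xz' : x < z j.+1.
    by rewrite ltNge -(lift_leE h) //; [rewrite lx /lift jb'; lra|lra].
  have jm : (j < m)%N by olia.
  have memz k : (0 < k <= m)%N -> z k \in Z m.
    by case: k => // k km; rewrite mem_nth // (partition_size hZ) //; olia.
  move: zx'; rewrite le_eqVlt => /orP[/eqP E|zx'].
    by rewrite -E memz ?(chord) /chord /= ?subrr ?mulr0 ?addr0 ?lexx //; olia.
  have -> : x \in Z m = false.
    apply/negP => xZ; have := nth_index 0 xZ.
    have := index_mem x (Z m); rewrite xZ (partition_size hZ) // => km E.
    have E' : z (index x (Z m)).+1 = x by rewrite /zpt /= E.
    case: (leqP (index x (Z m)).+1 j) => k; first by have := z_le (index x (Z m)).+1 j isT k (ltnW jm); lra.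
    by have := z_le j.+1 (index x (Z m)).+1 isT k km; lra.
  apply/negbTE; rewrite -ltNge /chord /=.
  have C : (iter h T x - iter h T (z j)) * (z j.+1 - x) < (iter h T (z j.+1) - iter h T x) * (x - z j).
    by apply: lift_convex => //; [lra|lra|rewrite jb jb'].
  have P : 0 < iter h T (z j.+1) - iter h T (z j) by lra.
  rewrite mulrAC -ltrBrDl ltr_pdivrMr //.
  by move: C; lra.
- move=> [/andP[_ yz] _].
  have : lift h x < lift h (z (dp i).+1) by rewrite lx /lift b1; lra.
  by rewrite ltNge lift_leE ?zx //; lra.
- move=> [/andP[yz _] _].
  have : lift h (z (dp i.+1)) <= lift h x by rewrite lx /lift b2; lra.
  by rewrite lift_leE //; lra.
- by move=> [E _]; move: tx; rewrite E ltxx andbF.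
Qed.

End grid.

(** All that the limit theorems use of a partition. In [good_hit] the point [x]
    stays one mesh away from the ends of its node, so that the segments ending
    at approximate nodes do not matter. *)
Record good_grid h (Z : nat -> seq R) m : Prop := GoodGrid {
  good_anode0 : anode s h Z m 0 = 0 ;
  good_anode_last : anode s h Z m (2 ^ h) = 1 ;
  good_range : forall i y, (i < 2 ^ h)%N -> 0 <= y <= 1 ->
    anode s h Z m i <= branch_inv s h Z m i y <= anode s h Z m i.+1 ;
  good_anode : forall i, (i <= 2 ^ h)%N -> `|anode s h Z m i - node h i| <= mesh Z m ;
  good_inv : forall i y, (i < 2 ^ h)%N -> 0 <= y <= 1 ->
    `|branch_inv s h Z m i y - lift_inv h (i%:R + y)| <= mesh Z m ;
  good_ucont : forall i, (i < 2 ^ h)%N -> ucont (branch_inv s h Z m i) ;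
  good_hit : forall i x, (i < 2 ^ h)%N -> node h i + mesh Z m < x ->
    x < node h i.+1 - mesh Z m ->
    (x <= branch_inv s h Z m i (iter h T x)) = (x \in Z m) }.

Lemma good_grid_near h (Z : nat -> seq R) (e : R) : (0 < h)%N -> refining_partitions Z ->
  0 < e -> \forall m \near \oo, good_grid h Z m /\ mesh Z m <= e.
Proof.
move=> hh hZ e0.
have p3 : (0 : R) < 3 ^+ h by rewrite exprn_gt0.
have e'0 : 0 < (3 ^+ h)^-1 / 3 :> R by rewrite divr_gt0 ?invr_gt0.
have cv (a : R) : 0 < a -> \forall m \near \oo, `|0 - mesh Z m| <= a.
  by move=> a0; have /cvgrPdist_le := partition_mesh hZ; apply.
near=> m.
have m2 : (2 <= m)%N by near: m; exact: nbhs_infty_ge.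
have M0 := mesh_ge0 Z m.
have Me : mesh Z m <= e.
  have : `|0 - mesh Z m| <= e by near: m; exact: cv.
  by rewrite sub0r normrN ger0_norm.
have sm : 3 ^+ h * mesh Z m < 1 / 2.
  have : `|0 - mesh Z m| <= (3 ^+ h)^-1 / 3 by near: m; exact: cv.
  rewrite sub0r normrN ger0_norm // => H.
  have : 3 ^+ h * mesh Z m <= 3 ^+ h * ((3 ^+ h)^-1 / 3) by rewrite ler_pM2l.
  by rewrite mulrA divff ?gt_eqF //; lra.
split => //; split.
- exact: anode0.
- exact: anode_last.
- by move=> i y i2 y01; have [] := branch_inv_spec h hh Z hZ m m2 sm i y i2 y01.
- exact: anode_near.
- by move=> i y i2 y01; have [] := branch_inv_spec h hh Z hZ m m2 sm i y i2 y01.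
- exact: branch_inv_ucont.
- move=> i x i2 x1 x2; apply: branch_inv_hit => //.
  have [_ _ _ a4] := block_left h hh Z hZ m m2 sm i i2.
  by have [_ _ _ a8] := block_right h hh Z hZ m m2 sm i i2; lra.
Unshelve. all: by end_near. Qed.

Lemma anode_le h Z m i j : good_grid h Z m -> (i <= j)%N -> (j <= 2 ^ h)%N ->
  anode s h Z m i <= anode s h Z m j.
Proof.
move=> G; elim: j => [|j IH]; first by rewrite leqn0 => /eqP->.
rewrite leq_eqVlt => /orP[/eqP->//|ij] j2; apply: le_trans (IH ij (ltnW j2)) _.
by have := good_range _ _ _ G j 0 j2; rewrite lexx ler01 => /(_ isT)/andP[]; exact: le_trans.
Qed.

Lemma anode_itv h Z m i : good_grid h Z m -> (i <= 2 ^ h)%N -> 0 <= anode s h Z m i <= 1.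
Proof.
move=> G i2; rewrite -{1}(good_anode0 _ _ _ G) -(good_anode_last _ _ _ G).
by rewrite !(anode_le _ _ _ _ _ G).
Qed.

Lemma branch_inv_itv h Z m i (y : R) : good_grid h Z m -> (i < 2 ^ h)%N -> 0 <= y <= 1 ->
  0 <= branch_inv s h Z m i y <= 1.
Proof.
move=> G i2 y01; have := good_range _ _ _ G i y i2 y01.
have := anode_itv _ _ _ i G (ltnW i2); have := anode_itv _ _ _ i.+1 G i2.
lra.
Qed.

(** * The invariant measure and the copula at lag h *)
Section measure.
Context (mu : probability R R) (hmu : is_MP_measure s mu).
Local Notation F0 := (df mu).

Lemma mu_null (A : set R) : measurable A -> lebesgue_measure A = 0%E -> mu A = 0%E.
Proof.
move=> mA A0; apply/(measure0_null_setP mu mA).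
by apply: (MP_measure_ac hmu); exact/measure0_null_setP.
Qed.

Lemma mu_set1 (a : R) : mu [set a] = 0%E.
Proof. by apply: mu_null; [exact: measurable_set1|exact: lebesgue_measure_set1]. Qed.

Lemma mu_null_sub (A B : set R) : measurable A -> measurable B -> mu B = 0%E ->
  A `<=` B -> mu A = 0%E.
Proof.
move=> mA mB B0 AB; rewrite prE //; congr (_%:E).
by apply: (pr_null_sub mu _ B) => //; rewrite /pr B0.
Qed.

Lemma measurable_unit_interval : measurable (unit_interval : set R). Proof. exact: measurable_itv. Qed.

Lemma pr_I : pr mu unit_interval = 1.
Proof. by rewrite /pr (MP_measure_carrier hmu). Qed.

Lemma pr_CI : pr mu (~` unit_interval) = 0.
Proof.
have mC : measurable (~` unit_interval : set R) by apply: measurableC; exact: measurable_unit_interval.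
have := prU mu _ _ measurable_unit_interval mC; rewrite setICr setUv prT pr_I => /(_ erefl); lra.
Qed.

Lemma df0 : F0 0 = 0.
Proof.
rewrite /df; apply: (pr_null_sub mu _ (~` unit_interval `|` [set 0])).
- exact: measurable_itv.
- apply: measurableU; [apply: measurableC; exact: measurable_unit_interval|exact: measurable_set1].
- apply: pr_nullU; [apply: measurableC; exact: measurable_unit_interval|exact: measurable_set1|exact: pr_CI|].
  by rewrite /pr mu_set1.
- move=> x /=; rewrite in_itv /= le_eqVlt => /orP[/eqP->|x0]; [by right|left].
  by rewrite /unit_interval /= in_itv /= => /andP[]; lra.
Qed.

Lemma df1 : F0 1 = 1.
Proof.
apply: le_anti; apply/andP; split.
  rewrite -(prT mu); apply: pr_le => //; exact: measurable_itv.
rewrite -[leLHS]pr_I; apply: pr_le; try exact: measurable_itv.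
by move=> x; rewrite /unit_interval /= !in_itv /= => /andP[].
Qed.

(** The integral of a positive density over a nondegenerate interval is
    positive. *)
Lemma df_lt (x y : R) : 0 <= x -> x < y -> y <= 1 -> F0 x < F0 y.
Proof.
move=> x0 xy y1; have [f [mf f0 fE]] := MP_measure_density hmu.
rewrite lt_neqAle (df_le _ _ _ (ltW xy)) andbT; apply/eqP => E.
have mxy : measurable (`]x, y] : set R) by exact: measurable_itv.
have xyI : (`]x, y] : set R) `<=` unit_interval.
  by move=> w; rewrite /unit_interval /= !in_itv /= => /andP[]; lra.
have Z : (\int[lebesgue_measure]_(w in `]x, y]) `|(f w)%:E| = 0)%E.
  transitivity (\int[lebesgue_measure]_(w in `]x, y]) (f w)%:E)%E.
    by apply: eq_integral => w /set_mem /xyI /f0 fw; rewrite gee0_abs // lee_fin ltW.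
  by rewrite -fE // prE // pr_itv ?(ltW xy) // E subrr.
have mf' : measurable_fun `]x, y] (EFin \o f).
  by apply/measurable_EFinP; exact: measurable_funS mf.
have /(negligibleS (A := _)) := (ae_eq_integral_abs lebesgue_measure mxy mf').1 Z.
move=> /(_ `]x, y]%classic); rewrite negligibleP //.
have L : lebesgue_measure (`]x, y]%classic : set R) != 0%E.
  by rewrite lebesgue_measure_itv /= lte_fin xy -EFinB eqe subr_eq0 gt_eqF.
move=> H; move/eqP: L; apply.
apply: H => w wxy /= /(_ wxy) [] fw; have := f0 w (xyI _ wxy); lra.
Qed.

(** Absolute continuity of the integral of the density. *)
Lemma df_ucont : ucont F0.
Proof.
have [f [mf f0 fE]] := MP_measure_density hmu.
have If : lebesgue_measure.-integrable setT (EFin \o (f \_ unit_interval)).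
  rewrite -restrict_EFin -integrable_mkcond; last exact: measurable_unit_interval.
  apply/integrableP; split.
    by apply/measurable_EFinP; exact: measurable_funS mf.
  have -> : (\int[lebesgue_measure]_(w in unit_interval) `|(EFin \o f) w| =
             \int[lebesgue_measure]_(w in unit_interval) (f w)%:E)%E.
    by apply: eq_integral => w /set_mem /f0 fw; rewrite gee0_abs // lee_fin ltW.
  by rewrite -fE //; [rewrite (MP_measure_carrier hmu) ltry|exact: measurable_unit_interval].
apply: ucont_le => e e0.
have [dl [d0 H]] := integral_normr_continuous If e0.
exists dl => // x y x0 xy y1 xyd.
have mxy : measurable (`]x, y] : set R) by exact: measurable_itv.
have xyI : (`]x, y] : set R) `<=` unit_interval.
  by move=> w; rewrite /unit_interval /= !in_itv /= => /andP[]; lra.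
have L : (lebesgue_measure (`]x, y]%classic : set R) < dl%:E)%E.
  by rewrite lebesgue_measure_itv /=; case: ifP => _; rewrite -?EFinB lte_fin.
have := H _ mxy L.
have -> : \int[lebesgue_measure]_(w in `]x, y]) `|(f \_ unit_interval) w| = F0 y - F0 x.
  rewrite -pr_itv // /pr fE // /Rintegral; congr fine; apply: eq_integral.
  move=> w /set_mem /xyI wI; rewrite patchE mem_set // ger0_norm //; exact/ltW/f0.
by move=> /ltW; rewrite ger0_norm // subr_ge0 df_le.
Qed.

Lemma df_itv (x : R) : 0 <= x <= 1 -> 0 <= F0 x <= 1.
Proof. by move=> /andP[x0 x1]; rewrite -[X in X <= _]df0 -[X in _ && (_ <= X)]df1 !df_le. Qed.

Definition quantile (v : R) : R := xget 0 [set x : R | 0 <= x <= 1 /\ F0 x = v].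
Local Notation Q := quantile.

Lemma quantileP (v : R) : 0 <= v <= 1 -> 0 <= Q v <= 1 /\ F0 (Q v) = v.
Proof.
move=> v01; have [|x x01 xv] := ucont_ivt F0 v df_ucont; first by rewrite df0 df1.
by have : [set x : R | 0 <= x <= 1 /\ F0 x = v] (Q v) by exact: (xgetI 0 (x := x)).
Qed.

Lemma df_inj (x y : R) : 0 <= x <= 1 -> 0 <= y <= 1 -> F0 x = F0 y -> x = y.
Proof.
move=> /andP[x0 x1] /andP[y0 y1] E; case: (ltgtP x y) => // xy.
  by have := df_lt x y x0 xy y1; rewrite E ltxx.
by have := df_lt y x y0 xy x1; rewrite E ltxx.
Qed.

Lemma dfK (x : R) : 0 <= x <= 1 -> Q (F0 x) = x.
Proof. by move=> x01; have [q01 qE] := quantileP _ (df_itv _ x01); exact: df_inj. Qed.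

Lemma quantile_le (u v : R) : 0 <= u -> u <= v -> v <= 1 -> Q u <= Q v.
Proof.
move=> u0 uv v1; have [|q01 qE] := quantileP u; first by rewrite u0 (le_trans uv).
have [|r01 rE] := quantileP v; first by rewrite v1 (le_trans u0).
rewrite leNgt; apply/negP => lt; have := df_lt (Q v) (Q u); rewrite qE rE.
by lra.
Qed.

Lemma measurable_MP : measurable_fun setT (MP s).
Proof.
have mS : measurable_fun setT (fun x : R => x + x `^ (1 + s)).
  by apply: measurable_funD => //; exact: measurable_powR.
rewrite /MP; apply: measurable_fun_ifT => //.
  by apply: measurable_fun_ltr.
exact: measurable_funB.
Qed.

Lemma measurable_iter n : measurable_fun setT (iter n T).
Proof.
elim: n => [|n IH]; first exact: measurable_id.
exact: measurableT_comp measurable_MP IH.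
Qed.

Lemma measurable_iter_pre n (A : set R) : measurable A -> measurable (iter n T @^-1` A).
Proof. by move=> mA; rewrite -[X in measurable X]setTI; exact: measurable_iter. Qed.

Lemma pr_iter n (A : set R) : measurable A -> pr mu (iter n T @^-1` A) = pr mu A.
Proof.
move=> mA; elim: n => [//|n <-]; rewrite {2}/pr.
rewrite -(MP_measure_invariant hmu); last exact: measurable_iter_pre.
by rewrite /pr; congr (fine (mu _)); apply/funext => x /=; rewrite -iterSr.
Qed.

(** The joint distribution function of [w] and [iter h T w] is the measure of
    this event. *)
Definition corner h (a b : R) : set R :=
  unit_interval `&` `]-oo, a] `&` iter h T @^-1` `]-oo, b].

Lemma measurable_corner h a b : measurable (corner h a b).
Proof.
apply: measurableI; last by apply: measurable_iter_pre; exact: measurable_itv.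
by apply: measurableI; exact: measurable_itv.
Qed.

(** On the k-th node, [iter h T w <= b] means [w <= lift_inv h (k%:R + b)], so
    that the event is an interval there. The nodes are added one at a time. *)
Lemma pr_corner h (a b : R) : 0 <= a <= 1 -> 0 <= b <= 1 ->
  pr mu (corner h a b) = \sum_(k < 2 ^ h)
    Num.max 0 (F0 (Num.min a (lift_inv h (k%:R + b))) - F0 (node h k)).
Proof.
move=> a01 b01.
have mc := measurable_corner h a b.
have mray (x : R) : measurable (`]-oo, x[ : set R) by exact: measurable_itv.
suff H K : (K <= 2 ^ h)%N -> pr mu (corner h a b `&` `]-oo, node h K[) =
    \sum_(k < K) Num.max 0 (F0 (Num.min a (lift_inv h (k%:R + b))) - F0 (node h k)).
  rewrite -H // node_last; apply: (pr_eq_off mu _ _ [set 1 : R]).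
  - by [].
  - exact: measurableI.
  - exact: measurable_set1.
  - by rewrite /pr mu_set1.
  move=> w w1; split => [cw|[]//]; split => //=; rewrite in_itv /=.
  case: cw => -[wI _] _; move: wI; rewrite /unit_interval /= in_itv /= => /andP[_].
  by rewrite le_eqVlt => /orP[/eqP|//].
elim: K => [|K IH] K2.
  rewrite big_ord0 node0; apply: (pr_null_sub _ _ set0) => //; first exact: measurableI.
    by rewrite /pr measure0.
  move=> w [[[wI _] _]] /=; move: wI; rewrite /unit_interval /= !in_itv /= => /andP[w0 _].
  by rewrite ltNge w0.
have v := node_itv h K b K2 b01.
have vK := node_itv0 h K (ltnW K2).
have vK1 := node_itv0 h K.+1 K2.
have [c01 cE] := lift_invP h _ v; have [n01 nE] := lift_invP h _ vK.
have [p01 pE] := lift_invP h _ vK1.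
set e := lift_inv h (K%:R + b) in c01 cE *.
rewrite -/(node h K) in n01 nE *; rewrite -/(node h K.+1) in p01 pE *.
have nn : node h K <= node h K.+1 by apply: node_le.
have mnode : measurable (`[node h K, node h K.+1[ : set R) by exact: measurable_itv.
have -> : corner h a b `&` `]-oo, node h K.+1[ =
    (corner h a b `&` `]-oo, node h K[) `|` (corner h a b `&` `[node h K, node h K.+1[).
  rewrite -setIUr; congr (_ `&` _); apply/seteqP; split => w /=; rewrite !in_itv /=.
    by move=> wK; case: (ltP w (node h K)) => _; [left|right].
  by case=> [wK|/andP[]//]; exact: lt_le_trans nn.
rewrite prU; [|exact: measurableI|exact: measurableI|]; last first.
  apply/seteqP; split => // w [[_] /=]; rewrite !in_itv /= => wK [_ /andP[]].
  by rewrite leNgt wK.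
rewrite big_ord_recr /= -IH; last exact: ltnW.
congr (_ + _); rewrite -/e.
have ep : e <= node h K.+1 by rewrite -(lift_leE h) // pE cE -natr1; lra.
have sub w : (corner h a b `&` `[node h K, node h K.+1[) w <->
    node h K <= w < node h K.+1 /\ w <= Num.min a e.
  rewrite /corner /unit_interval /setI /= !in_itv /= le_min.
  have W : node h K <= w < node h K.+1 -> 0 <= w < 1 /\ lift h w = K%:R + iter h T w.
    move=> nw; have w01 : 0 <= w < 1 by lra.
    split => //; have /eqP B : branch h w == K.
      rewrite branchP //; rewrite natr1 -nE -pE lift_leE //; last by lra.
      by apply/andP; split; [lra|apply: lift_lt; lra].
    by rewrite /lift B.
  have key : 0 <= w < 1 -> lift h w = K%:R + iter h T w -> (w <= e) = (iter h T w <= b).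
    by move=> w01 lw; rewrite -(lift_leE h) //; [rewrite cE lw lerD2l|lra].
  split => [[[[w01 wa] wb] nw]|[nw /andP[wa we]]]; have [w01' lw] := W nw.
    by rewrite nw wa key.
  by rewrite -key // we nw wa; do !split => //; lra.
case: (leP (node h K) (Num.min a e)) => [nc|cn].
  rewrite (max_idPr _); last by rewrite subr_ge0 df_le.
  apply: pr_between => //; [exact: mu_set1|exact: measurableI| |].
    move=> w /=; rewrite in_itv /= => wc; apply/sub; split; last by lra.
    have : Num.min a e <= e by rewrite ge_min lexx orbT.
    by lra.
  by move=> w /sub /= [nw wc]; rewrite in_itv /=; lra.
rewrite (max_idPl _); last by rewrite subr_le0 df_le // ltW.
apply: (pr_null_sub _ _ set0) => //; [exact: measurableI|by rewrite /pr measure0|].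
by move=> w /sub [nw wc]; lra.
Qed.

(** The joint distribution function above, after both marginals, which equal
    [F0], are made uniform. *)
Definition lag_copula h (uv : R * R) : R := pr mu (corner h (Q uv.1) (Q uv.2)).

Lemma pr_corner_le h (a b : R) (A : set R) : measurable A -> corner h a b `<=` A ->
  pr mu A = 0 -> pr mu (corner h a b) = 0.
Proof. by move=> mA cA A0; apply: (pr_null_sub _ _ A) => //; exact: measurable_corner. Qed.

Lemma quantile0 : Q 0 = 0.
Proof. by rewrite -{1}df0 dfK // lexx ler01. Qed.

Lemma quantile1 : Q 1 = 1.
Proof. by rewrite -{1}df1 dfK // lexx ler01. Qed.

Lemma pr_corner_band h (a b1 b2 : R) : b1 <= b2 ->
  pr mu (corner h a b2) - pr mu (corner h a b1) =
  pr mu (unit_interval `&` `]-oo, a] `&` iter h T @^-1` `]b1, b2]).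
Proof.
move=> b12.
have mband : measurable (unit_interval `&` `]-oo, a] `&` iter h T @^-1` `]b1, b2]).
  apply: measurableI; last by apply: measurable_iter_pre; exact: measurable_itv.
  by apply: measurableI; exact: measurable_itv.
have -> : corner h a b2 = corner h a b1 `|`
    (unit_interval `&` `]-oo, a] `&` iter h T @^-1` `]b1, b2]).
  rewrite /corner -setIUr -preimage_setU; congr (_ `&` (_ @^-1` _)).
  apply/seteqP; split => w /=; rewrite !in_itv /=.
    by move=> wb; case: (leP w b1) => _; [left|right].
  by case=> [wb|/andP[]//]; exact: le_trans b12.
rewrite prU //; [by rewrite addrAC subrr add0r|exact: measurable_corner|].
apply/seteqP; split => // w [[_ /=]]; rewrite in_itv /= => wb [_ /=].
by rewrite in_itv /= ltNge wb.
Qed.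

Lemma lag_copula_is_copula h : is_copula (lag_copula h).
Proof.
have UI (u : R) : unit_interval u -> 0 <= u <= 1 by rewrite /unit_interval /= in_itv.
have pr0 : pr mu `]-oo, 0] = 0 by exact: df0.
split => /=.
- move=> u _; rewrite /lag_copula /= quantile0.
  apply: (@pr_corner_le _ _ _ (iter h T @^-1` `]-oo, 0])).
  + by apply: measurable_iter_pre; exact: measurable_itv.
  + by move=> w [].
  + by rewrite pr_iter //; exact: measurable_itv.
- move=> v _; rewrite /lag_copula /= quantile0.
  apply: (@pr_corner_le _ _ _ `]-oo, 0]%classic).
  + exact: measurable_itv.
  + by move=> w [] [].
  + exact: pr0.
- move=> u /UI u01; rewrite /lag_copula /= quantile1.
  have [q01 qE] := quantileP _ u01.
  rewrite -{2}qE -[RHS]subr0 -df0; apply: pr_between.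
  + exact: mu_set1.
  + exact: measurable_corner.
  + lra.
  + move=> w /=; rewrite in_itv /= => wq; rewrite /corner /unit_interval /setI /= !in_itv /=.
    have : 0 <= iter h T w <= 1 by apply: iter_le1; lra.
    by move=> /andP[_ ->]; do !split => //; lra.
  + move=> w [[]]; rewrite /unit_interval /= !in_itv /=; lra.
- move=> v /UI v01; rewrite /lag_copula /= quantile1.
  have [q01 qE] := quantileP _ v01.
  rewrite -{2}qE /df -[RHS](pr_iter h); last exact: measurable_itv.
  apply: (pr_eq_off _ _ _ (~` unit_interval)).
  + exact: measurable_corner.
  + by apply: measurable_iter_pre; exact: measurable_itv.
  + by apply: measurableC; exact: measurable_unit_interval.
  + exact: pr_CI.
  + move=> w /contrapT wI; split => [[]//|wb]; split => //; split => //.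
    by move: wI; rewrite /unit_interval /= !in_itv /= => /andP[].
- move=> u1 u2 v1 v2 /UI u1I /UI u2I /UI v1I /UI v2I u12 v12; rewrite /lag_copula /=.
  have q1 : Q u1 <= Q u2 by apply: quantile_le; lra.
  have q2 : Q v1 <= Q v2 by apply: quantile_le; lra.
  have := pr_corner_band h (Q u2) _ _ q2; have := pr_corner_band h (Q u1) _ _ q2.
  set B1 := unit_interval `&` _ `&` _; set B2 := unit_interval `&` _ `&` _.
  have mB a : measurable (unit_interval `&` `]-oo, a] `&` iter h T @^-1` `](Q v1), (Q v2)]).
    apply: measurableI; last by apply: measurable_iter_pre; exact: measurable_itv.
    by apply: measurableI; exact: measurable_itv.
  have : pr mu B1 <= pr mu B2.
    apply: pr_le; [exact: mB|exact: mB|].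
    apply: setSI; apply: setIS => w /=; rewrite !in_itv /= => wq; exact: le_trans q1.
  by lra.
Qed.

(** * The copula of the process *)
Section process.
Context {d : measure_display} {Om : measurableType d} (P : probability Om R).
Context (U0 : {RV P >-> R})
  (hU0 : forall A : set R, measurable A -> distribution P U0 A = mu A).
Context (phi : R -> R) (phi_incr : ae_increasing phi).
Context (X : nat -> {RV P >-> R}) (hX : forall t w, X t w = phi (iter t T (U0 w))).

Lemma measurable_rv (Y : {RV P >-> R}) (A : set R) : measurable A -> measurable (Y @^-1` A).
Proof. by move=> mA; exact: measurable_funPTI. Qed.

Let V t w := iter t T (U0 w).

Lemma measurable_V t (A : set R) : measurable A -> measurable (V t @^-1` A).
Proof.
by move=> mA; apply: (measurable_rv U0 (iter t T @^-1` A)); exact: measurable_iter_pre.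
Qed.

Lemma pr_V t (A : set R) : measurable A -> pr P (V t @^-1` A) = pr mu A.
Proof.
move=> mA; have mB : measurable (iter t T @^-1` A) by exact: measurable_iter_pre.
by rewrite -(pr_iter t) // /pr -hU0.
Qed.

Lemma ae_increasing_null : exists N : set R,
  [/\ measurable N, pr mu N = 0, lebesgue_measure.-negligible N &
    forall x y, (unit_interval `\` N) x -> (unit_interval `\` N) y -> x < y -> phi x < phi y].
Proof.
have [N0 [N [mN N_0 N0N]] inc] := phi_incr.
have sub x : (unit_interval `\` N) x -> (unit_interval `\` N0) x.
  by move=> [Ix Nx]; split => // /N0N.
exists N; split => //.
- by rewrite /pr mu_null.
- exact/negligibleP.
- by move=> x y /sub Ix /sub Iy; exact: inc.
Qed.

(** Off the null event where one of the two iterates leaves the unit interval,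
    meets [N] or equals its cut, the events on both sides coincide. *)
Lemma joint_law N t h (x y c e : R) : measurable N -> pr mu N = 0 ->
  cuts phi N x c -> cuts phi N y e ->
  pr P (X t @^-1` `]-oo, x] `&` X (t + h)%N @^-1` `]-oo, y]) = pr mu (corner h c e).
Proof.
move=> mN N0 cx cy.
pose B (a : R) := ~` unit_interval `|` N `|` [set a].
have mCI : measurable (~` unit_interval : set R) by apply: measurableC; exact: measurable_unit_interval.
have m1 (a : R) : measurable [set a] by exact: measurable_set1.
have mB a : measurable (B a) by apply: measurableU => //; exact: measurableU.
have B0 a : pr mu (B a) = 0.
  apply: pr_nullU => //; first exact: measurableU.
    by apply: pr_nullU => //; exact: pr_CI.
  by rewrite /pr mu_set1.
have mc := measurable_corner h c e.
rewrite -(pr_V t) //.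
apply: (pr_eq_off _ _ _ (V t @^-1` B c `|` V (t + h) @^-1` B e)).
- by apply: measurableI; apply: measurable_rv; exact: measurable_itv.
- exact: measurable_V.
- by apply: measurableU; apply: measurable_V.
- by apply: pr_nullU; rewrite ?pr_V //; apply: measurable_V.
move=> w nw.
have good a k : ~ (V k @^-1` B a) w -> (unit_interval `\` N) (V k w) /\ V k w != a.
  move=> nB; split.
    split; first by apply: contrapT => nI; apply: nB; left; left.
    by move=> VN; apply: nB; left; right.
  by apply/eqP => E; apply: nB; right.
have [|g1 g2] := good c t; first by move=> b; apply: nw; left.
have [|g3 g4] := good e (t + h)%N; first by move=> b; apply: nw; right.
have Vth : iter h T (V t w) = V (t + h) w by rewrite /V addnC iterD.
rewrite /corner /setI /preimage /= !in_itv /= !hX -/(V t w) -/(V (t + h) w) Vth.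
rewrite cx // cy //; split => [[]|[[]]]; by case: g1.
Qed.

Lemma marginal_law N t (x c : R) : measurable N -> pr mu N = 0 -> 0 <= c <= 1 ->
  cuts phi N x c -> fine (cdf (X t) x) = F0 c.
Proof.
move=> mN N0 c01 cx; rewrite /cdf /distribution /pushforward.
have -> : X t @^-1` `]-oo, x] = X t @^-1` `]-oo, x] `&` X (t + 0)%N @^-1` `]-oo, x].
  by rewrite addn0 setIid.
rewrite -/(pr _ _) (joint_law N t 0 x x c c) //.
rewrite -[RHS]subr0 -df0; apply: pr_between.
- exact: mu_set1.
- exact: measurable_corner.
- by case/andP: c01.
- move=> w; rewrite /corner /setI /preimage /unit_interval /= !in_itv /=; lra.
- by move=> w [[]]; rewrite /unit_interval /= !in_itv /=; lra.
Qed.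

Lemma lag_copula_of t h : copula_of (X t) (X (t + h)%N) (lag_copula h).
Proof.
split; first exact: lag_copula_is_copula.
move=> x y; have [N [mN N0 _ inc]] := ae_increasing_null.
have [c c01 cx] := level_cut phi N inc x; have [e e01 ey] := level_cut phi N inc y.
rewrite (marginal_law N t x c) // (marginal_law N (t + h) y e) //.
rewrite /lag_copula /= !dfK //.
rewrite -(joint_law N t h x y c e) // -prE //.
by apply: measurableI; apply: measurable_rv; exact: measurable_itv.
Qed.

(** By [cut_level] both marginal distribution functions take all values of the
    open unit interval, where Sklar's relation thus determines the copula; on
    the boundary of the square all copulas agree. *)
Lemma copula_unique t h (C : R * R -> R) : copula_of (X t) (X (t + h)%N) C ->
  forall uv, unit_square uv -> C uv = lag_copula h uv.
Proof.
move=> [cC CE] [u v] [/= uI vI].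
have [cL LE] := lag_copula_of t h.
have [N [mN N0 negN inc]] := ae_increasing_null.
have UI (a : R) : unit_interval a -> 0 <= a <= 1 by rewrite /unit_interval /= in_itv.
have ends (a : R) : unit_interval a -> [\/ a = 0, a = 1 | 0 < a < 1].
  move=> /UI /andP[a0 a1]; case: (ltgtP a 0) => // a0'; [lra| |by constructor 1].
  case: (ltgtP a 1) => // a1'; [by constructor 3|lra|by constructor 2].
case: (ends u uI) => [->|->|u01]; first by rewrite (copula_0v cC) // (copula_0v cL).
  by rewrite (copula_1v cC) // (copula_1v cL).
case: (ends v vI) => [->|->|v01]; first by rewrite (copula_u0 cC) // (copula_u0 cL).
  by rewrite (copula_u1 cC) // (copula_u1 cL).
have inner (a : R) : 0 < a < 1 -> 0 < Q a < 1.
  move=> /andP[a0 a1]; have [|/andP[q0 q1] qE] := quantileP a; first lra.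
  rewrite !lt_neqAle q0 q1 !andbT; apply/andP; split; apply/eqP => E.
    by move: qE; rewrite -E df0; lra.
  by move: qE; rewrite E df1; lra.
have [x cx] := cut_level phi N inc negN _ (inner _ u01).
have [y cy] := cut_level phi N inc negN _ (inner _ v01).
have [qu01 quE] := quantileP u (UI _ uI); have [qv01 qvE] := quantileP v (UI _ vI).
have E := EFin_inj (etrans (esym (CE x y)) (LE x y)).
rewrite (marginal_law N t x (Q u)) // (marginal_law N (t + h) y (Q v)) // in E.
by rewrite quE qvE in E.
Qed.

End process.

(** * Empirical distribution functions *)
Section empirical.
Context (x0 : R) (hx0 : 0 < x0 < 1) (hx0mu : weak_cvg_emp s x0 mu).

Local Notation x j := (iter j T x0).
Local Notation emp := (mu_emp s x0).
Local Notation Fh := (Fhat s x0).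
Local Notation Fc := (Fn s x0).

Lemma emp_le n (A B : set R) : (forall j, (j < n)%N -> A (x j) -> B (x j)) ->
  emp n A <= emp n B.
Proof.
move=> AB; rewrite /mu_emp ler_wpM2l ?invr_ge0 //; apply: ler_sum => j _.
rewrite !indicE; case: (boolP (_ \in A)) => [/set_mem /(AB _ (ltn_ord j)) /mem_set ->//|_].
by rewrite ler0n.
Qed.

Lemma emp_eq n (A B : set R) : (forall j, (j < n)%N -> A (x j) <-> B (x j)) ->
  emp n A = emp n B.
Proof. by move=> AB; apply: le_anti; rewrite !emp_le // => j /AB[]. Qed.

Lemma emp_ge0 n A : 0 <= emp n A.
Proof. by rewrite /mu_emp mulr_ge0 ?invr_ge0 // sumr_ge0. Qed.

Lemma emp_set0 n A : (forall j, (j < n)%N -> ~ A (x j)) -> emp n A = 0.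
Proof.
move=> nA; rewrite /mu_emp big1 ?mulr0 // => j _.
by rewrite indicE memNset //; exact: nA.
Qed.

Lemma emp_full n A : (0 < n)%N -> (forall j, (j < n)%N -> A (x j)) -> emp n A = 1.
Proof.
move=> n0 HA; rewrite /mu_emp (eq_bigr (fun=> 1)); last first.
  by move=> j _; rewrite indicE mem_set //; exact: HA.
by rewrite sumr_const card_ord -mulr_natl mulr1 mulVf // pnatr_eq0 -lt0n.
Qed.

Lemma emp_itv n (a b : R) : 0 <= a -> a <= b ->
  emp n `[a, b] = Fh n b - Fh n a + emp n [set a].
Proof.
move=> a0 ab; rewrite /Fhat /mu_emp -mulrBr -mulrDr -sumrB -big_split /=; congr (_ * _).
apply: eq_bigr => j _; rewrite !indicE !mem_setE /= !in_itv /=.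
move: (x j) => w; have -> : (w \in [set a]) = (w == a) by apply/idP/eqP; rewrite inE.
have [->|] := eqVneq w a; first by rewrite a0 lexx ab /=; ring.
rewrite neq_lt => /orP[wa|aw].
  by rewrite (ltW (lt_le_trans wa ab)) (ltW wa) (leNgt a) wa andbT /=; ring.
by rewrite (ltW aw) (le_trans a0 (ltW aw)) (leNgt w a) aw /=; ring.
Qed.

(** An orbit that meets the fixed point 0 stays there, and its empirical
    measures converge to the Dirac measure at 0, which [mu] is not. *)
Lemma atom_at_zero_absurd j : x j = 0 -> False.
Proof.
move=> xj; have m1 : measurable [set 0 : R] by exact: measurable_set1.
have null : mu (closure [set 0 : R] `\` [set 0 : R]^°) = 0%E.
  have c : closure [set 0 : R] = [set 0].
    by rewrite -(closure_id _).1 //; exact: accessible_closed_set1.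
  apply: (mu_null_sub _ [set 0]) => //; last by rewrite c => w [].
    rewrite c; apply: measurableD => //; apply: open_measurable; exact: open_interior.
  exact: mu_set1.
have := hx0mu [set 0] m1 null; rewrite mu_set1 => /fine_cvg /cvgrPdist_le.
move=> /(_ (1 / 4) ltac:(lra))[N _ H].
have := H (j + (j + N).+1)%N; rewrite /= => /(_ ltac:(lia)).
rewrite sub0r normrN ger0_norm ?emp_ge0 //.
rewrite /mu_emp big_split_ord /= mulrDr.
have -> : \sum_(i < (j + N).+1) \1_[set 0] (iter (j + i) T x0) = (j + N).+1%:R :> R.
  rewrite -[X in X%:R]card_ord -sumr_const; apply: eq_bigr => i _.
  by rewrite indicE mem_set //= addnC iterD xj iter0.
set S := (X in _ * X + _); have S0 : 0 <= S by apply: sumr_ge0.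
have n0 : (0 : R) < (j + (j + N).+1)%:R by rewrite ltr0n addnS.
have /mulr_ge0 /(_ S0) : 0 <= (j + (j + N).+1)%:R^-1 :> R by rewrite invr_ge0.
have : 1 / 2 <= (j + (j + N).+1)%:R^-1 * (j + N).+1%:R :> R.
  rewrite [leRHS]mulrC ler_pdivlMr //.
  have : (j + (j + N).+1)%:R <= 2 * (j + N).+1%:R :> R by rewrite -natrM ler_nat; lia.
  lra.
by lra.
Qed.

Lemma orbit_itv j : 0 < x j < 1.
Proof.
have /andP[a b] : 0 <= x j < 1 by apply: iter_lt1; case/andP: hx0 => /ltW -> ->.
rewrite b andbT lt_neqAle a andbT; apply/eqP => E.
by apply: (atom_at_zero_absurd j); rewrite -E.
Qed.

Lemma Fhat_cvg (a : R) : 0 <= a <= 1 -> (fun n => Fh n a) @ \oo --> F0 a.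
Proof.
move=> /andP[a0 a1]; rewrite /Fhat.
have mA : measurable (`[0, a] : set R) by exact: measurable_itv.
have null : mu (closure (`[0, a]%classic : set R) `\` (`[0, a]%classic : set R)^°) = 0%E.
  have c : closure (`[0, a]%classic : set R) = `[0, a]%classic.
    by rewrite -(closure_id _).1 //; exact: itv_closed.
  have mu0a : measurable ([set 0] `|` [set a] : set R).
    by apply: measurableU; exact: measurable_set1.
  apply: (mu_null_sub _ ([set 0] `|` [set a])) => //.
  - rewrite c; apply: measurableD => //; apply: open_measurable; exact: open_interior.
  - have := pr_nullU mu [set 0] [set a].
    rewrite {1 2}/pr !mu_set1 => /(_ (measurable_set1 _) (measurable_set1 _) erefl erefl) E.
    by rewrite prE ?E.
  - rewrite c => w [] /=; rewrite in_itv /= => /andP[w0 wa] nI.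
    case: (eqVneq w 0) => [->|w0']; first by left.
    case: (eqVneq w a) => [->|wa']; first by right.
    exfalso; apply: nI; have sub : `]0, a[%classic `<=` (`[0, a]%classic : set R).
      by apply: subset_itv; rewrite bnd_simp.
    apply: (filterS sub); apply: open_nbhs_nbhs; split; first exact: itv_open.
    by rewrite /= in_itv /= !lt_neqAle eq_sym w0' w0 wa' wa.
have := hx0mu _ mA null; have -> : mu `[0, a]%classic = (F0 a)%:E.
  rewrite prE //; congr (_%:E); have -> : F0 a = F0 a - F0 0 by rewrite df0 subr0.
  apply: pr_between => //.
  - exact: mu_set1.
  - by apply: subset_itv; rewrite bnd_simp.
by move=> /fine_cvg.
Qed.

Lemma Fhat_le n (a b : R) : a <= b -> Fh n a <= Fh n b.
Proof.
move=> ab; apply: emp_le => j _ /=; rewrite !in_itv /= => /andP[-> wa].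
exact: le_trans ab.
Qed.

Lemma Fhat0 n : Fh n 0 = 0.
Proof.
apply: emp_set0 => j _ /=; rewrite in_itv /= => /andP[_].
by have := orbit_itv j; lra.
Qed.

Lemma Fhat1 n : (0 < n)%N -> Fh n 1 = 1.
Proof.
move=> n0; apply: emp_full => // j _ /=; rewrite in_itv /=.
by have := orbit_itv j; lra.
Qed.

Lemma emp_set1_le n (a b : R) : 0 <= a -> a < b -> emp n [set b] <= Fh n b - Fh n a.
Proof.
move=> a0 ab; have := emp_itv n b b (le_trans a0 (ltW ab)) (lexx b).
have := emp_itv n a b a0 (ltW ab).
suff : emp n [set a] + emp n [set b] <= emp n `[a, b] by lra.
rewrite /mu_emp -mulrDr ler_wpM2l ?invr_ge0 // -big_split /=; apply: ler_sum => j _.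
rewrite !indicE !mem_setE /= !in_itv /=; move: (x j) => w.
have E c : (w \in [set c]) = (w == c) by apply/idP/eqP; rewrite inE.
rewrite !E; have [->|wa] := eqVneq w a; first by rewrite lexx (ltW ab) lt_eqF //= addr0.
have [->|wb] := eqVneq w b; first by rewrite lexx (ltW ab) /= add0r.
by rewrite addr0 ler0n.
Qed.

(** The control of atoms is what makes closed intervals and the interpolation
    of the distribution function as close to their limits as [Fhat] is. *)
Definition emp_close n (e : R) :=
  forall a, 0 <= a <= 1 -> `|Fh n a - F0 a| <= e /\ emp n [set a] <= e.

(** Polya's argument: monotone functions that are close on a fine grid are close
    everywhere when the limit is continuous. An atom is at most the increment of
    [Fhat] over any interval ending there. *)
Lemma emp_close_near (e : R) : 0 < e -> \forall n \near \oo, emp_close n e.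
Proof.
move=> e0; have e6 : 0 < e / 6 by lra.
have [dl d0 Hd] := df_ucont _ e6.
have [N N0 Nd] := grid_mesh _ d0.
have Np : (0 : R) < N%:R by rewrite ltr0n.
have gI i : (i <= N)%N -> 0 <= (i%:R / N%:R : R) <= 1.
  by move=> iN; rewrite divr_ge0 //= ler_pdivrMr // mul1r ler_nat.
have near_grid : \forall n \near \oo, forall i : 'I_N.+1,
    `|F0 (i%:R / N%:R) - Fh n (i%:R / N%:R)| <= e / 6.
  apply: filter_forall => i; have := Fhat_cvg (i%:R / N%:R) (gI i (ltn_ord i)).
  by move=> /cvgrPdist_le; apply.
near=> n.
have G0 : forall i : 'I_N.+1, `|F0 (i%:R / N%:R) - Fh n (i%:R / N%:R)| <= e / 6.
  by near: n.
have G i : (i <= N)%N -> `|F0 (i%:R / N%:R) - Fh n (i%:R / N%:R)| <= e / 6.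
  by move=> iN; have := G0 (inord i); rewrite inordK.
have P a : 0 <= a <= 1 -> `|Fh n a - F0 a| <= e / 3.
  move=> a01; have [i iN /andP[ia ai]] := grid_point _ _ N0 a01.
  have E : i.+1%:R / N%:R = i%:R / N%:R + N%:R^-1 :> R by rewrite -natr1 mulrDl mul1r.
  have := G i (ltnW iN); have := G i.+1 iN.
  have D : `|F0 (i.+1%:R / N%:R) - F0 (i%:R / N%:R)| <= e / 6.
    apply: Hd; [exact: gI|exact/gI/ltnW|].
    by rewrite E addrAC subrr add0r ger0_norm // invr_ge0 ltW.
  have := Fhat_le n _ _ ia; have := Fhat_le n _ _ ai.
  have := df_le mu _ _ ia; have := df_le mu _ _ ai.
  by move: D; rewrite !ler_norml; lra.
move=> a a01; split; first by have := P a a01; rewrite !ler_norml; lra.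
have [->|a0] := eqVneq a 0.
  have : emp n [set 0] <= Fh n 0.
    by apply: emp_le => j _ ->; rewrite /= in_itv /= lexx.
  by rewrite Fhat0; lra.
have a0' : 0 < a by case/andP: a01 => p _; rewrite lt_neqAle eq_sym a0.
pose b := Num.max 0 (a - dl / 2).
have b0 : 0 <= b by rewrite le_max lexx.
have ba : b < a by rewrite gt_max a0' /=; lra.
have bd : a - dl / 2 <= b by rewrite le_max lexx orbT.
have b01 : 0 <= b <= 1 by lra.
have := emp_set1_le n b a b0 ba; have := P a a01; have := P b b01.
have : `|F0 a - F0 b| <= e / 6 by apply: Hd => //; rewrite ger0_norm; lra.
by rewrite !ler_norml; lra.
Unshelve. all: by end_near. Qed.

Lemma emp_interval n (e a b : R) : emp_close n e -> 0 <= a <= 1 -> 0 <= b <= 1 ->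
  `|emp n `[a, b] - Num.max 0 (F0 b - F0 a)| <= 3 * e.
Proof.
move=> ce a01 b01; have [A1 A2] := ce a a01; have [B1 _] := ce b b01.
have e0 : 0 <= e by apply: le_trans A1.
case: (leP a b) => ab.
  rewrite emp_itv ?ab //; last by case/andP: a01.
  rewrite (max_idPr _); last by rewrite subr_ge0 df_le.
  by have := emp_ge0 n [set a]; move: A1 B1; rewrite !ler_norml; lra.
rewrite (max_idPl _); last by rewrite subr_le0 df_le // ltW.
rewrite emp_set0 ?subrr ?normr0; first lra.
by move=> j _ /=; rewrite in_itv /=; lra.
Qed.

Lemma orbit_pointsP n w : reflect (exists2 j, (j < n)%N & w = x j) (w \in orbit_points s x0 n).
Proof.
apply: (iffP mapP) => -[j jn ->]; exists j => //; first by move: jn; rewrite mem_iota.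
by rewrite mem_iota.
Qed.

Lemma mem_jumps n w : w \in 0 :: rcons (sort <=%R (orbit_points s x0 n)) 1 ->
  [\/ w = 0, w = 1 | exists2 j, (j < n)%N & w = x j].
Proof.
rewrite in_cons mem_rcons in_cons mem_sort => /orP[/eqP->|/orP[/eqP->|/orbit_pointsP]].
- by constructor 1.
- by constructor 2.
- by constructor 3.
Qed.

Lemma path_jumps n : path <=%R 0 (rcons (sort <=%R (orbit_points s x0 n)) 1).
Proof.
rewrite rcons_path; apply/andP; split.
  rewrite path_min_sorted ?sort_sorted //; first exact: le_total.
  by apply/allP => w; rewrite mem_sort => /orbit_pointsP[j _ ->]; have := orbit_itv j; lra.
have := mem_last 0 (sort <=%R (orbit_points s x0 n)).
rewrite in_cons mem_sort => /orP[/eqP->|/orbit_pointsP[j _ ->]]; first exact: ler01.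
by have := orbit_itv j; lra.
Qed.

Lemma Fn_locate n (a : R) : 0 <= a < 1 -> exists q r : R,
  [/\ 0 <= q, q <= a < r, r <= 1,
     (forall j, (j < n)%N -> x j <= q \/ r <= x j) &
     Fc n a = Fh n q + (Fh n r - Fh n q) / (r - q) * (a - q)].
Proof.
move=> /andP[a0 a1].
have [|q [r [qI rI qr H E]]] := interpolation_graph_locate (Fh n) _ _ a (path_jumps n) a0.
  by rewrite last_rcons.
have J w : w \in 0 :: rcons (sort <=%R (orbit_points s x0 n)) 1 -> 0 <= w <= 1.
  move=> /mem_jumps[->|->|[j _ ->]]; [by rewrite lexx ler01|by rewrite lexx ler01|].
  by have := orbit_itv j; lra.
have /andP[q0 _] := J q qI; have /andP[_ r1] := J r rI.
exists q, r; split => // j jn; apply: H.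
by rewrite in_cons mem_rcons in_cons mem_sort; apply/orP; right; apply/orP; right;
   apply/orbit_pointsP; exists j.
Qed.

Lemma Fn_lipschitz n : exists2 K, 0 <= K & forall a b, 0 <= a -> a <= b ->
  0 <= Fc n b - Fc n a <= K * (b - a).
Proof.
have := interpolation_lipschitz (0, Fh n 0)
  [seq (w, Fh n w) | w <- rcons (sort <=%R (orbit_points s x0 n)) 1]; apply.
pose f w : R * R := (w, Fh n w); rewrite -[(0, _)]/(f 0) -/f path_map.
apply: sub_path (path_jumps n) => a b ab; rewrite /step_le /=.
move: (ab); rewrite le_eqVlt => /orP[/eqP->|ab']; first by rewrite eqxx orbT.
by rewrite ab' Fhat_le.
Qed.

Lemma Fn_le n (a b : R) : 0 <= a -> a <= b -> Fc n a <= Fc n b.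
Proof. by move=> a0 ab; have [K _ /(_ a b a0 ab)] := Fn_lipschitz n; lra. Qed.

Lemma Fn_ucont n : ucont (Fc n).
Proof.
have [K K0 HK] := Fn_lipschitz n; apply: (lipschitz_ucont K) => // a b a0 ab _.
by have := HK a b a0 ab; rewrite ler_norml; lra.
Qed.

Lemma Fn_jump n j : (j < n)%N -> Fc n (x j) = Fh n (x j).
Proof.
move=> jn; have xj := orbit_itv j.
have [|q [r [q0 /andP[qa ar] r1 H ->]]] := Fn_locate n (x j); first lra.
have [xq|] := H j jn; last by lra.
have -> : q = x j by lra.
by rewrite subrr mulr0 addr0.
Qed.

Lemma emp_add n (A B C : set R) :
  (forall j, (j < n)%N -> A (x j) <-> B (x j) \/ C (x j)) ->
  (forall j, (j < n)%N -> B (x j) -> ~ C (x j)) -> emp n A = emp n B + emp n C.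
Proof.
move=> ABC BC; rewrite /mu_emp -mulrDr -big_split /=; congr (_ * _).
apply: eq_bigr => j _; have := ABC j (ltn_ord j); have := BC j (ltn_ord j).
rewrite !indicE; move: (x j) => w nBC E.
have [Bw|nB] := pselect (B w).
  by rewrite (mem_set Bw) (memNset (nBC Bw)) (mem_set (E.2 (or_introl Bw))) addr0.
have [Cw|nC] := pselect (C w).
  by rewrite (memNset nB) (mem_set Cw) (mem_set (E.2 (or_intror Cw))) add0r.
by rewrite (memNset nB) (memNset nC) addr0 memNset // => /E.1[].
Qed.

Lemma emp_set1_gt0 n j : (j < n)%N -> 0 < emp n [set x j].
Proof.
move=> jn; rewrite /mu_emp mulr_gt0 ?invr_gt0 ?ltr0n //; first exact: leq_ltn_trans jn.
rewrite (bigD1 (Ordinal jn)) //= indicE mem_set //.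
by rewrite ltr_pwDl // sumr_ge0.
Qed.

(** The point [r] is the next jump of [Fhat] after [a], or 1 if there is none. *)
Lemma Fn_between n (a : R) : 0 <= a < 1 ->
  exists2 r, a < r <= 1 & [/\ Fh n a <= Fc n a, Fc n a <= Fh n a + emp n [set r] &
    forall j, (j < n)%N -> a < x j -> Fc n a < Fc n (x j)].
Proof.
move=> a01; have [q [r [q0 /andP[qa ar] r1 H E]]] := Fn_locate n a a01.
exists r; first by rewrite ar.
have Fa : Fh n a = Fh n q.
  apply: emp_eq => j jn /=; rewrite !in_itv /=.
  by have [|] := H j jn => h1; split; lra.
have Fr : Fh n r = Fh n q + emp n [set r].
  apply: emp_add => j jn /=; rewrite !in_itv /=; last by move=> /andP[_ h1] h2; lra.
  have xj := orbit_itv j; have [|] := H j jn => h1.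
    by split => [_|]; [left|]; lra.
  split; [move=> h2; right; lra|case => h2; lra].
have D : 0 < r - q by lra.
have t0 : 0 <= (a - q) / (r - q) by rewrite divr_ge0 //; lra.
have t1 : (a - q) / (r - q) < 1 by rewrite ltr_pdivrMr //; lra.
have M := emp_ge0 n [set r].
have E' : Fc n a = Fh n q + emp n [set r] * ((a - q) / (r - q)).
  by rewrite E Fr addrAC subrr add0r; congr (_ + _); rewrite mulrAC mulrA.
move: ((a - q) / _) t0 t1 E' => t t0 t1 E'.
have le : Fc n a <= Fh n a + emp n [set r] by rewrite Fa E' lerD2l ler_piMr // ltW.
split => //; first by rewrite Fa E' lerDl mulr_ge0.
move=> j jn axj; rewrite Fn_jump //.
have rj : r <= x j by have [|//] := H j jn; lra.
have a0 : 0 <= a by case/andP: a01.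
move: M; rewrite le_eqVlt => /orP[/eqP M|M].
  have := emp_set1_le n a (x j) a0 axj; have := emp_set1_gt0 n j jn.
  by move: le; rewrite -M addr0; lra.
have := Fhat_le n _ _ rj; rewrite Fr E'.
have : emp n [set r] * t < emp n [set r] by rewrite gtr_pMr.
by lra.
Qed.

Lemma Fn0 n : Fc n 0 = 0.
Proof.
have [|q [r' [q0 /andP[qa ar] r1 _ ->]]] := Fn_locate n 0; first by rewrite lexx ltr01.
have -> : q = 0 by lra.
by rewrite Fhat0 subrr mulr0 addr0.
Qed.

Lemma Fn1 n : (0 < n)%N -> Fc n 1 = 1.
Proof.
move=> n0; rewrite -[RHS](Fhat1 n n0) /Fn.
pose f w : R * R := (w, Fh n w).
pose le1 (_ q : R * R) := q.1 <= 1.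
have all_path (l : seq (R * R)) p : all (fun q => q.1 <= 1) l -> path le1 p l.
  by elim: l p => //= q l IH p /andP[q1 /IH->]; rewrite andbT.
have := interpolation_locate le1 (f 0)
  [seq f w | w <- rcons (sort <=%R (orbit_points s x0 n)) 1] 1.
rewrite last_map last_rcons => H; case: H.
- apply: all_path; rewrite all_map; apply/allP => w /=; rewrite mem_rcons in_cons mem_sort.
  by move=> /orP[/eqP->|/orbit_pointsP[j _ ->]]; rewrite ?lexx //; have := orbit_itv j; lra.
- exact: ler01.
- by move=> [q [r [r1 /andP[_ qr] _]]]; move: r1; rewrite /le1 leNgt qr.
- by move=> [].
Qed.

Lemma Fn_close n (e : R) : emp_close n e -> (0 < n)%N -> forall a, 0 <= a <= 1 ->
  `|Fc n a - F0 a| <= 2 * e.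
Proof.
move=> ce n0 a a01; have e0 : 0 <= e by have [A _] := ce a a01; exact: le_trans A.
case: (ltP a 1) => a1; last first.
  have -> : a = 1 by lra.
  by rewrite Fn1 // df1 subrr normr0; lra.
have [|r ar [A B _]] := Fn_between n a; first by rewrite a1 andbT; case/andP: a01.
have [C _] := ce a a01; have [|_ D] := ce r; first by lra.
by move: C; rewrite !ler_norml; lra.
Qed.

Lemma Fn_invP n (u : R) : (0 < n)%N -> 0 <= u <= 1 ->
  0 <= Fn_inv s x0 n u <= 1 /\ Fc n (Fn_inv s x0 n u) = u.
Proof.
move=> n0 u01; apply: inf_level.
- exact: Fn_ucont.
- by move=> a b a0 ab _; exact: Fn_le.
- by rewrite Fn0 Fn1.
Qed.

(** [Fn] increases strictly up to each orbit point, so that its value at an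
    orbit point beyond the generalised inverse of [u] exceeds [u]. *)
Lemma orbit_le_Fn_inv n j (u a : R) : (j < n)%N -> 0 <= u <= 1 -> x j <= a -> Fc n a <= u ->
  x j <= Fn_inv s x0 n u.
Proof.
move=> jn u01 xa Fa; have n0 : (0 < n)%N by exact: leq_ltn_trans jn.
have [/andP[y0 y1] yE] := Fn_invP n u n0 u01; have xj := orbit_itv j.
rewrite leNgt; apply/negP => yx.
have [|r _ [_ _ H]] := Fn_between n (Fn_inv s x0 n u); first by rewrite y0; lra.
have := H j jn yx; rewrite yE.
have := Fn_le n (x j) a; lra.
Qed.

(** * Convergence of the estimator *)
Section estimator.
Context (h : nat) (hh : (0 < h)%N) (Z : nat -> seq R) (hZ : refining_partitions Z).

Local Notation an := (anode s h Z).
Local Notation bi := (branch_inv s h Z).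
Local Notation Fi := (Fn_inv s x0).
Local Notation C := (lag_copula h).

Lemma n0star_spec m n (u : R) : good_grid h Z m -> (0 < n)%N -> 0 <= u <= 1 ->
  let k := n0star s h Z m x0 n u in
  (k < 2 ^ h)%N /\ (u = 1 /\ k = (2 ^ h).-1 \/ Fc n (an m k) <= u < Fc n (an m k.+1)).
Proof.
move=> G n0 u01; have p2 : (0 < 2 ^ h)%N by rewrite expn_gt0.
rewrite /n0star; case: eqP => [->|/eqP u1] /=; first by split; [lia|left].
set P := (fun k => _).
have hasP : has P (iota 0 (2 ^ h)).
  have [K K2 PK] : exists2 K, (K < 2 ^ h)%N & P K.
    have : Fc n (an m 0) <= u < Fc n (an m (2 ^ h)).
      rewrite (good_anode0 _ _ _ G) (good_anode_last _ _ _ G) Fn0 Fn1 //.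
      by case/andP: u01 => -> ul; rewrite lt_neqAle u1 ul.
    elim: (2 ^ h)%N => [/andP[a b]|K IH /andP[a b]]; first by move: (le_lt_trans a b); rewrite ltxx.
    case: (ltP u (Fc n (an m K))) => uK.
      by have [|i iK Pi] := IH; [rewrite a uK|exists i => //; exact: ltnW].
    by exists K => //; rewrite /P uK b.
  by apply/hasP; exists K => //; rewrite mem_iota.
have fs := hasP; rewrite has_find size_iota in fs.
by split => //; right; have := nth_find 0%N hasP; rewrite nth_iota.
Qed.

(** On each node left of the one where the level [u] is reached, the constraint
    by [Fn_inv u] holds for all orbit points concerned; on each node right of it,
    it holds for none. So the index [n0star] may be dropped. *)
Lemma CmnE m n (u v : R) : good_grid h Z m -> (0 < n)%N -> 0 <= u <= 1 -> 0 <= v <= 1 ->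
  Cmn s h Z m x0 n (u, v) =
  \sum_(k < 2 ^ h) emp n `[an m k, Num.min (Fi n u) (bi m k (Fi n v))].
Proof.
move=> G n0 u01 v01; have [k2 kP] := n0star_spec m n u G n0 u01.
have [yv01 yvE] := Fn_invP n v n0 v01; have [yu01 yuE] := Fn_invP n u n0 u01.
rewrite /Cmn; move: k2 kP; set k := n0star _ _ _ _ _ _ _ => k2 kP.
pose f i := emp n `[an m i, Num.min (Fi n u) (bi m i (Fi n v))].
have left_nodes i : (i < k)%N -> emp n `[an m i, bi m i (Fi n v)] = f i.
  move=> ik; apply: emp_eq => j jn /=; rewrite !in_itv /= le_min.
  split; last by move=> /andP[-> /andP[_ ->]].
  move=> /andP[ax xb]; rewrite ax xb andbT /=.
  apply: (orbit_le_Fn_inv n j u (an m k)) => //.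
    have /andP[_ b] := good_range _ _ _ G i _ (ltn_trans ik k2) yv01.
    by apply: le_trans xb (le_trans b _); apply: (anode_le h Z m i.+1 k) => //; exact: ltnW.
  case: kP => [[-> _]|/andP[]//].
  have /andP[a0 a1] := anode_itv h Z m k G (ltnW k2).
  by rewrite -(Fn1 n n0); apply: Fn_le.
have right_nodes i : (k < i)%N -> (i < 2 ^ h)%N -> f i = 0.
  move=> ki i2; apply: emp_set0 => j jn /=; rewrite in_itv /= le_min => /andP[ax /andP[xu _]].
  case: kP => [[_ kE]|/andP[_ uk]].
    have : (i <= k)%N by rewrite kE -ltnS prednK ?expn_gt0.
    by rewrite leqNgt ki.
  have := anode_le h Z m k.+1 i G ki (ltnW i2) => kn.
  have /andP[a0 _] := anode_itv h Z m k.+1 G k2.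
  have := Fn_le n (an m k.+1) (Fi n u) a0; rewrite yuE.
  by have : an m k.+1 <= Fi n u by [lra]; lra.
have -> : (\sum_(i < k) emp n `[an m i, bi m i (Fi n v)]) * (0 < k)%N%:R = \sum_(i < k) f i.
  rewrite (eq_bigr (fun i : 'I_k => f i)) => [|i _]; last exact: left_nodes.
  by case: (k) => [|k' /=]; rewrite ?big_ord0 ?mul0r // mulr1.
rewrite -/(f k) -(big_mkord xpredT f) -(big_mkord xpredT f).
rewrite (@big_cat_nat _ _ _ k.+1 0 (2 ^ h)) //= big_nat_recr //=.
by rewrite [X in _ = _ + X]big_nat_cond [X in _ = _ + X]big1 ?addr0 // => i /andP[/andP[ki i2] _];
   exact: right_nodes.
Qed.

(** The measure of [[a, b]], empty if [b < a], in terms of the values of the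
    distribution function at its ends. *)
Definition excess (a b : R) := Num.max 0 (b - a).

Lemma excess_dist (a b a' b' : R) : `|excess a b - excess a' b'| <= `|a - a'| + `|b - b'|.
Proof.
rewrite /excess; have := ler_norm (a - a'); have := ler_norm (b - b').
have := ler_norm (a' - a); have := ler_norm (b' - b); rewrite (distrC a') (distrC b').
by case: (leP 0 (b - a)) => ?; case: (leP 0 (b' - a')) => ?; rewrite ler_norml; lra.
Qed.

Lemma min_dist (a b a' b' : R) : `|Num.min a b - Num.min a' b'| <= `|a - a'| + `|b - b'|.
Proof.
have := ler_norm (a - a'); have := ler_norm (b - b').
have := ler_norm (a' - a); have := ler_norm (b' - b); rewrite (distrC a') (distrC b').
by case: (leP a b) => ?; case: (leP a' b') => ?; rewrite ler_norml; lra.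
Qed.

Lemma df_min (a b : R) : F0 (Num.min a b) = Num.min (F0 a) (F0 b).
Proof.
case: (leP a b) => ab; first by rewrite (min_idPl _) // df_le.
by rewrite (min_idPr _) // df_le // ltW.
Qed.

(** The limit of the estimator as [n] grows, for a fixed partition. *)
Definition grid_copula m (uv : R * R) : R :=
  \sum_(k < 2 ^ h) excess (F0 (an m k)) (Num.min uv.1 (F0 (bi m k (Q uv.2)))).

Lemma lag_copulaE (u v : R) : 0 <= u <= 1 -> 0 <= v <= 1 ->
  C (u, v) = \sum_(k < 2 ^ h)
    excess (F0 (node h k)) (Num.min u (F0 (lift_inv h (k%:R + Q v)))).
Proof.
move=> u01 v01; have [qu01 quE] := quantileP u u01; have [qv01 qvE] := quantileP v v01.
by rewrite /lag_copula pr_corner //; apply: eq_bigr => k _; rewrite df_min quE.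
Qed.

(** In each term, [5 * e] accounts for the empirical measure of the interval
    ([3 * e]) and for [F0 (Fn_inv u)] in place of [u] ([2 * e]), and [2 * g]
    for its two ends. The ends are arbitrary since the lemma serves for the
    limits with exact and with approximate nodes. *)
Lemma Cmn_dist m n (e g : R) (F : nat -> R) (G : nat -> R) (u v : R) :
  good_grid h Z m -> (0 < n)%N -> emp_close n e -> 0 <= u <= 1 -> 0 <= v <= 1 ->
  (forall k, (k < 2 ^ h)%N -> `|F0 (an m k) - F k| <= g) ->
  (forall k, (k < 2 ^ h)%N -> `|F0 (bi m k (Fi n v)) - G k| <= g) ->
  `|Cmn s h Z m x0 n (u, v) - \sum_(k < 2 ^ h) excess (F k) (Num.min u (G k))| <=
  (2 ^ h)%:R * (5 * e + 2 * g).
Proof.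
move=> Gd n0 ce u01 v01 HF HG; rewrite CmnE // -sumrB.
apply: le_trans (ler_norm_sum _ _ _) _.
rewrite -[X in X%:R * _]card_ord mulr_natl -sumr_const; apply: ler_sum => k _.
have [yv01 yvE] := Fn_invP n v n0 v01; have [yu01 yuE] := Fn_invP n u n0 u01.
have b01 := branch_inv_itv h Z m k _ Gd (ltn_ord k) yv01.
have a01 := anode_itv h Z m k Gd (ltnW (ltn_ord k)).
have m01 : 0 <= Num.min (Fi n u) (bi m k (Fi n v)) <= 1.
  by rewrite le_min ge_min; case/andP: yu01 => -> ->; case/andP: b01 => ->.
have E1 := emp_interval n e _ _ ce a01 m01.
have U : `|F0 (Fi n u) - u| <= 2 * e.
  by have := Fn_close n e ce n0 _ yu01; rewrite yuE distrC.
have E2 := excess_dist (F0 (an m k)) (F0 (Num.min (Fi n u) (bi m k (Fi n v))))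
  (F k) (Num.min u (G k)).
have E3 := min_dist (F0 (Fi n u)) (F0 (bi m k (Fi n v))) u (G k).
rewrite -df_min in E3; have K1 := HF k (ltn_ord k); have K2 := HG k (ltn_ord k).
set A := emp _ _ in E1 *; rewrite -/(excess _ _) in E1.
have := ler_normD (A - excess (F0 (an m k)) (F0 (Num.min (Fi n u) (bi m k (Fi n v)))))
  (excess (F0 (an m k)) (F0 (Num.min (Fi n u) (bi m k (Fi n v)))) - excess (F k) (Num.min u (G k))).
by rewrite addrA subrK; lra.
Qed.

Lemma quantile_near (e : R) : 0 < e -> \forall n \near \oo, forall v, 0 <= v <= 1 ->
  `|Fi n v - Q v| <= e.
Proof.
move=> e0; have [dl d0 H] := increasing_inverse_ucont F0 df_lt e e0.
near=> n; have n0 : (0 < n)%N by near: n; exact: nbhs_infty_gt.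
have ce : emp_close n (dl / 3) by near: n; apply: emp_close_near; lra.
move=> v v01; have [q01 qE] := quantileP v v01; have [y01 yE] := Fn_invP n v n0 v01.
apply: H => //; have := Fn_close n _ ce n0 _ y01; rewrite yE qE distrC => K.
by apply: le_lt_trans K _; lra.
Unshelve. all: by end_near. Qed.

Let K0 : (0 : R) < (2 ^ h)%:R. Proof. by rewrite ltr0n expn_gt0. Qed.

Lemma lift_inv_dist k (a b : R) : (k < 2 ^ h)%N -> 0 <= a <= 1 -> 0 <= b <= 1 ->
  `|lift_inv h (k%:R + a) - lift_inv h (k%:R + b)| <= `|a - b|.
Proof.
move=> k2.
wlog ab : a b / a <= b => [H a01 b01|a01 b01].
  by case: (leP a b) => [/H|/ltW/H ba]; [exact|rewrite distrC (distrC a); exact: ba].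
have /andP[a1 _] := node_itv h k a k2 a01; have /andP[_ b1] := node_itv h k b k2 b01.
have := lift_inv_lip h _ (k%:R + b) a1 _ b1; rewrite lerD2l => /(_ ab)/andP[l0 l1].
by rewrite distrC (distrC a) !ger0_norm; lra.
Qed.

Lemma Cmn_joint (e : R) : 0 < e -> exists M N : nat, forall m n, (M <= m)%N -> (N <= n)%N ->
  forall u v, 0 <= u <= 1 -> 0 <= v <= 1 ->
  `|Cmn s h Z m x0 n (u, v) - C (u, v)| <= e.
Proof.
move=> e0; pose K : R := (2 ^ h)%:R.
have eK : 0 < e / K by rewrite divr_gt0.
have [dl d0 Hd] := df_ucont (e / K / 4) ltac:(lra).
have [M _ HM] := good_grid_near h Z (dl / 4) hh hZ ltac:(lra).
have [N _ HN] : \forall n \near \oo, [/\ (0 < n)%N, emp_close n (e / K / 10) &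
    forall v, 0 <= v <= 1 -> `|Fi n v - Q v| <= dl / 4].
  near=> n; split; near: n; first exact: nbhs_infty_gt.
    by apply: emp_close_near; lra.
  by apply: quantile_near; lra.
(* The fractions of [e / K] add up in [Cmn_dist]: [5 * (1 / 10) + 2 * (1 / 4) = 1]. *)
exists M, N => m n /HM[G mm] /HN[n0 ce qn] u v u01 v01.
have [q01 _] := quantileP v v01; have [y01 _] := Fn_invP n v n0 v01.
rewrite lag_copulaE //.
have -> : e = K * (5 * (e / K / 10) + 2 * (e / K / 4)).
  have -> : 5 * (e / K / 10) + 2 * (e / K / 4) = e / K by field.
  by rewrite mulrC divfK // gt_eqF.
apply: (Cmn_dist m n _ _ (fun k => F0 (node h k)) (fun k => F0 (lift_inv h (k%:R + Q v)))) => //.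
  move=> k k2; apply: Hd.
  - by apply: anode_itv => //; exact: ltnW.
  - by have [] := lift_invP h k%:R (node_itv0 h k (ltnW k2)).
  - by have := good_anode _ _ _ G k (ltnW k2); lra.
move=> k k2; apply: Hd.
- exact: branch_inv_itv.
- by have [] := lift_invP h _ (node_itv h k (Q v) k2 q01).
have A := good_inv _ _ _ G k _ k2 y01; have B := lift_inv_dist k _ _ k2 y01 q01.
have D := qn v v01.
have := ler_normD (bi m k (Fi n v) - lift_inv h (k%:R + Fi n v))
  (lift_inv h (k%:R + Fi n v) - lift_inv h (k%:R + Q v)).
by rewrite addrA subrK; lra.
Unshelve. all: by end_near. Qed.

Lemma Cmn_grid m (e : R) : good_grid h Z m -> 0 < e -> \forall n \near \oo,
  forall u v, 0 <= u <= 1 -> 0 <= v <= 1 ->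
  `|Cmn s h Z m x0 n (u, v) - grid_copula m (u, v)| <= e.
Proof.
move=> G e0; pose K : R := (2 ^ h)%:R.
have eK : 0 < e / K by rewrite divr_gt0.
have [dl d0 Hd] := df_ucont (e / K / 4) ltac:(lra).
have step : \forall n \near \oo, forall k : 'I_(2 ^ h), forall v, 0 <= v <= 1 ->
    `|F0 (bi m k (Fi n v)) - F0 (bi m k (Q v))| <= e / K / 4.
  apply: filter_forall => k.
  have [d1 d10 H1] := good_ucont _ _ _ G k (ltn_ord k) (dl / 2) ltac:(lra).
  near=> n; have n0 : (0 < n)%N by near: n; exact: nbhs_infty_gt.
  have qn : forall v, 0 <= v <= 1 -> `|Fi n v - Q v| <= d1 / 2.
    by near: n; apply: quantile_near; lra.
  move=> v v01; have [q01 _] := quantileP v v01; have [y01 _] := Fn_invP n v n0 v01.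
  apply: Hd; [exact: branch_inv_itv|exact: branch_inv_itv|].
  have : `|bi m k (Fi n v) - bi m k (Q v)| <= dl / 2.
    by apply: H1 => //; have := qn v v01; lra.
  by lra.
near=> n; have n0 : (0 < n)%N by near: n; exact: nbhs_infty_gt.
have ce : emp_close n (e / K / 10) by near: n; apply: emp_close_near; lra.
have st : forall k : 'I_(2 ^ h), forall v, 0 <= v <= 1 ->
    `|F0 (bi m k (Fi n v)) - F0 (bi m k (Q v))| <= e / K / 4 by near: n.
move=> u v u01 v01.
have -> : e = K * (5 * (e / K / 10) + 2 * (e / K / 4)).
  have -> : 5 * (e / K / 10) + 2 * (e / K / 4) = e / K by field.
  by rewrite mulrC divfK // gt_eqF.
apply: (Cmn_dist m n _ _ (fun k => F0 (an m k)) (fun k => F0 (bi m k (Q v)))) => //.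
  by move=> k k2; rewrite subrr normr0; lra.
by move=> k k2; exact: (st (Ordinal k2)).
Unshelve. all: by end_near. Qed.

Lemma grid_copula_cvg (e : R) : 0 < e -> \forall m \near \oo,
  forall u v, 0 <= u <= 1 -> 0 <= v <= 1 -> `|grid_copula m (u, v) - C (u, v)| <= e.
Proof.
move=> e0; have [M [N H]] := Cmn_joint (e / 2) ltac:(lra).
near=> m; have Mm : (M <= m)%N by near: m; exact: nbhs_infty_ge.
have [G _] : good_grid h Z m /\ mesh Z m <= 1 by near: m; exact: good_grid_near.
have [N' _ H'] := Cmn_grid m (e / 2) G ltac:(lra).
move=> u v u01 v01; have A := H m (maxn N N') Mm (leq_maxl _ _) u v u01 v01.
have B := H' (maxn N N') (leq_maxr _ _) u v u01 v01.
have := ler_normB (Cmn s h Z m x0 (maxn N N') (u, v) - C (u, v))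
  (Cmn s h Z m x0 (maxn N N') (u, v) - grid_copula m (u, v)).
by rewrite opprB addrC addrA subrK; lra.
Unshelve. all: by end_near. Qed.

Definition ultimately_constant (f : nat -> R) := exists l, \forall m \near \oo, f m = l.

Lemma ultimately_constant_sum N (f : 'I_N -> nat -> R) :
  (forall k, ultimately_constant (f k)) -> ultimately_constant (fun m => \sum_k f k m).
Proof.
move=> H; have [l Hl] := choice H; exists (\sum_k l k).
by apply: filterS (filter_forall _ Hl) => m E; apply: eq_bigr => k _.
Qed.

(** No orbit point is a node, as it would be mapped to 0. *)
Lemma orbit_in_node j : let i := branch h (x j) in
  [/\ (i < 2 ^ h)%N, lift h (x j) = i%:R + iter h T (x j),
      0 < iter h T (x j) < 1 & node h i < x j < node h i.+1].
Proof.
have xj := orbit_itv j; have xj1 : 0 <= x j < 1 by lra.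
have i2 := branch_lt h (x j); move=> i; rewrite -/i in i2 *.
have := orbit_itv (h + j); rewrite iterD => tj.
have lx : lift h (x j) = i%:R + iter h T (x j) by [].
split => //; apply/andP; split.
  rewrite ltNge lift_inv_geE ?lx; [|exact/node_itv0/ltnW|lra].
  by rewrite -ltNge ltrDl; case/andP: tj.
by rewrite ltNge lift_inv_leE ?lx; [rewrite -ltNge -natr1 ltrD2l; case/andP: tj|exact: node_itv0|lra].
Qed.

(** Only the node of the orbit point matters for large [m]. There the position
    of the point with respect to the exact inverse decides, unless both are
    equal; then [good_hit] applies, and membership in nested sets is monotone. *)
Lemma hit_ultimately_constant j k n (u v : R) : (k < 2 ^ h)%N -> (0 < n)%N ->
  0 <= u <= 1 -> 0 <= v <= 1 ->
  ultimately_constant (fun m => \1_(`[an m k, Num.min (Fi n u) (bi m k (Fi n v))]%classic) (x j)).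
Proof.
move=> k2 n0 u01 v01; have [y01 _] := Fn_invP n v n0 v01.
have [i2 lx tx /andP[nx xn]] := orbit_in_node j; set i := branch h (x j) in i2 lx nx xn.
suff [b Hb] : exists b : bool, \forall m \near \oo,
    [&& an m k <= x j, x j <= Fi n u & x j <= bi m k (Fi n v)] = b.
  exists b%:R; apply: filterS Hb => m <-.
  by rewrite indicE mem_setE /= in_itv /= le_min.
have GM (e : R) : 0 < e -> \forall m \near \oo, good_grid h Z m /\ mesh Z m <= e.
  exact: good_grid_near.
have [ki|ik|ki] := ltngtP k i.
- exists false; have Gm := GM ((x j - node h i) / 2) ltac:(lra); apply: filterS Gm => m [G mm].
  apply/negbTE; apply/negP => /and3P[_ _].
  have /andP[_ A] := good_range _ _ _ G k _ k2 y01.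
  have B := anode_le h Z m k.+1 i G ki (ltnW i2).
  have := good_anode _ _ _ G i (ltnW i2); rewrite ler_norml; lra.
- exists false; have Gm := GM ((node h i.+1 - x j) / 2) ltac:(lra); apply: filterS Gm => m [G mm].
  apply/negbTE; apply/negP => /and3P[A _ _].
  have B := anode_le h Z m i.+1 k G ik (ltnW k2).
  have := good_anode _ _ _ G i.+1 i2; rewrite ler_norml; lra.
rewrite ki.
have left_true : \forall m \near \oo, an m i <= x j.
  have Gm := GM ((x j - node h i) / 2) ltac:(lra); apply: filterS Gm => m [G mm].
  by have := good_anode _ _ _ G i (ltnW i2); rewrite ler_norml; lra.
suff [b Hb] : exists b : bool, \forall m \near \oo, (x j <= bi m i (Fi n v)) = b.
  exists ((x j <= Fi n u) && b); near=> m.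
  have -> : an m i <= x j by near: m.
  by have -> : (x j <= bi m i (Fi n v)) = b by near: m.
have v' := node_itv h i (Fi n v) i2 y01.
have [c01 cE] := lift_invP h _ v'; set c := lift_inv h (i%:R + Fi n v) in c01 cE.
have xj := orbit_itv j.
have [xc|cx|xc] := ltgtP (x j) c.
- exists true; have Gm := GM ((c - x j) / 2) ltac:(lra); apply: filterS Gm => m [G mm].
  have := good_inv _ _ _ G i _ i2 y01; rewrite -/c ler_norml; lra.
- exists false; have Gm := GM ((x j - c) / 2) ltac:(lra); apply: filterS Gm => m [G mm].
  apply/negbTE; rewrite -ltNge.
  have := good_inv _ _ _ G i _ i2 y01; rewrite -/c ler_norml; lra.
have E : iter h T (x j) = Fi n v by move: cE; rewrite -xc lx => /addrI.
have hits : \forall m \near \oo, (x j <= bi m i (Fi n v)) = (x j \in Z m).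
  pose dl := Num.min (x j - node h i) (node h i.+1 - x j).
  have dl0 : 0 < dl by rewrite lt_min !subr_gt0 nx xn.
  have Gm := GM (dl / 2) ltac:(lra); apply: filterS Gm => m [G mm].
  have d1 : dl <= x j - node h i by rewrite ge_min lexx.
  have d2 : dl <= node h i.+1 - x j by rewrite ge_min lexx orbT.
  by rewrite -E; apply: (good_hit _ _ _ G) => //; lra.
have [[m0 m02 xZ]|nZ] := pselect (exists2 m0, (2 <= m0)%N & x j \in Z m0).
  exists true; near=> m.
  have -> : (x j <= bi m i (Fi n v)) = (x j \in Z m) by near: m.
  have m0m : (m0 <= m)%N by near: m; exact: nbhs_infty_ge.
  rewrite -(subnKC m0m); elim: (m - m0)%N => [|p IH]; first by rewrite addn0.
  by rewrite addnS; apply: (partition_nested hZ) => //; exact: leq_trans (leq_addr _ _).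
exists false; near=> m.
have -> : (x j <= bi m i (Fi n v)) = (x j \in Z m) by near: m.
apply/negbTE/negP => xZ; apply: nZ; exists m => //.
by near: m; exact: nbhs_infty_ge.
Unshelve. all: by end_near. Qed.

Lemma Cmn_ultimately_constant n (u v : R) : (0 < n)%N -> 0 <= u <= 1 -> 0 <= v <= 1 ->
  ultimately_constant (fun m => Cmn s h Z m x0 n (u, v)).
Proof.
move=> n0 u01 v01.
have [l Hl] : ultimately_constant (fun m => \sum_(k < 2 ^ h)
    emp n `[an m k, Num.min (Fi n u) (bi m k (Fi n v))]).
  apply: ultimately_constant_sum => k.
  have [l Hl] : ultimately_constant (fun m => \sum_(j < n)
      \1_(`[an m k, Num.min (Fi n u) (bi m k (Fi n v))]%classic) (x j)).
    by apply: ultimately_constant_sum => j; exact: hit_ultimately_constant.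
  by exists (n%:R^-1 * l); apply: filterS Hl => m <-.
exists l; apply: filterS2 Hl (good_grid_near h Z 1 hh hZ ltr01) => m <- [G _].
exact: CmnE.
Qed.

End estimator.

End empirical.

End measure.

End manneville_pomeau.

(** * The theorem *)
Lemma uniform_cvg_unit_square {R : realType} {I : Type} (F : set_system I) {FF : Filter F}
    (f : I -> R * R -> R) (g : R * R -> R) :
  (forall e : R, 0 < e -> \forall i \near F, forall u v : R, 0 <= u <= 1 -> 0 <= v <= 1 ->
     `|f i (u, v) - g (u, v)| <= e) ->
  {uniform unit_square, f @ F --> g}.
Proof.
move=> H P /uniform_nbhs[E [entE EP]].
move: entE; rewrite -entourage_ballE => -[e /= e0 eE].
have H2 := H (e / 2) ltac:(lra); apply: filterS H2 => i Hi; apply: EP => -[u v] [/=].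
rewrite /unit_interval /= !in_itv /= => u01 v01; apply: eE.
rewrite /= /ball /= distrC; have := Hi u v u01 v01; lra.
Qed.

Lemma filter_prod_nat (P : nat * nat -> Prop) M N :
  (forall m n, (M <= m)%N -> (N <= n)%N -> P (m, n)) -> \forall mn \near (\oo, \oo), P mn.
Proof.
move=> H; exists ([set m | (M <= m)%N], [set n | (N <= n)%N]).
  by split => /=; [exists M|exists N].
by move=> [m n] [/= Mm Nn]; exact: H.
Qed.

Theorem theorem5p1 (R : realType) (s : R) (hs0 : 0 < s) (hs1 : s < 1)
    (h : nat) (hh : (0 < h)%N)
    (mu : probability R R) (hmu : is_MP_measure s mu)
    (x0 : R) (hx0 : 0 < x0 < 1) (hx0mu : weak_cvg_emp s x0 mu)
    (d : measure_display) (Om : measurableType d) (P : probability Om R)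
    (U0 : {RV P >-> R})
    (hU0 : forall A : set R, measurable A -> distribution P U0 A = mu A)
    (phi : R -> R) (hphi : mu.-integrable unit_interval (EFin \o phi))
    (phi_incr : ae_increasing phi)
    (X : nat -> {RV P >-> R})
    (hX : forall t w, X t w = phi (iter t (MP s) (U0 w)))
    (Z : nat -> seq R) (hZ : refining_partitions Z) (t : nat) :
  exists C : R * R -> R,
    [/\ copula_of (X t) (X (t + h)%N) C,
        forall C', copula_of (X t) (X (t + h)%N) C' ->
          forall uv, unit_square uv -> C' uv = C uv,
        (exists L : nat -> R * R -> R,
          (forall n, (0 < n)%N -> forall uv, unit_square uv ->
             (fun m => Cmn s h Z m x0 n uv) @ \oo --> L n uv) /\
          {uniform unit_square, L @ \oo --> C}),
        (exists L : nat -> R * R -> R,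
          (\forall m \near \oo,
             {uniform unit_square, (fun n => Cmn s h Z m x0 n) @ \oo --> L m}) /\
          {uniform unit_square, L @ \oo --> C})
      & {uniform unit_square,
          (fun mn : nat * nat => Cmn s h Z mn.1 x0 mn.2) @ (\oo, \oo) --> C}].
Proof.
have square (uv : R * R) : unit_square uv ->
    exists u v, [/\ uv = (u, v), 0 <= u <= 1 & 0 <= v <= 1].
  case: uv => u v [/=]; rewrite /unit_interval /= !in_itv /= => u01 v01.
  by exists u, v.
have joint := Cmn_joint s hs0 hs1 mu hmu x0 hx0 hx0mu h hh Z hZ.
exists (lag_copula s mu h); split.
- exact: (lag_copula_of s hs0 hs1 mu hmu P U0 hU0 phi phi_incr X hX).
- exact: (copula_unique s hs0 hs1 mu hmu P U0 hU0 phi phi_incr X hX).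
- pose limit n uv := xget (0 : R) [set l | \forall m \near \oo, Cmn s h Z m x0 n uv = l].
  have limitP n u v : (0 < n)%N -> 0 <= u <= 1 -> 0 <= v <= 1 ->
      \forall m \near \oo, Cmn s h Z m x0 n (u, v) = limit n (u, v).
    move=> n0 u01 v01.
    have [l Hl] := Cmn_ultimately_constant s hs0 hs1 mu hmu x0 hx0 hx0mu h hh Z hZ
      n u v n0 u01 v01.
    have : [set l | \forall m \near \oo, Cmn s h Z m x0 n (u, v) = l] (limit n (u, v)).
      exact: (xgetI (0 : R) (x := l)).
    by [].
  exists limit; split.
    move=> n n0 uv /square[u [v [-> u01 v01]]].
    by apply: cvg_near_cst; exact: limitP.
  apply: uniform_cvg_unit_square => e /joint[M [N H]]; near=> n => u v u01 v01.
  have n0 : (0 < n)%N by near: n; exact: nbhs_infty_gt.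
  have Nn : (N <= n)%N by near: n; exact: nbhs_infty_ge.
  have [M' _ HM'] := limitP n u v n0 u01 v01.
  rewrite -(HM' (maxn M M') (leq_maxr _ _)).
  exact: H (leq_maxl _ _) Nn _ _ u01 v01.
- exists (grid_copula s mu h Z); split.
    apply: filterS (good_grid_near s hs0 hs1 h Z 1 hh hZ ltr01) => m [G _].
    apply: uniform_cvg_unit_square => e e0.
    exact: (Cmn_grid s hs0 hs1 mu hmu x0 hx0 hx0mu).
  apply: uniform_cvg_unit_square => e e0.
  exact: (grid_copula_cvg s hs0 hs1 mu hmu x0 hx0 hx0mu).
- apply: uniform_cvg_unit_square => e /joint[M [N H]].
  by apply: (filter_prod_nat _ M N) => m n Mm Nn u v u01 v01; exact: H.
Unshelve. all: by end_near. Qed.
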